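(* Let $A$ be a C*-algebra. For any $\mathbf{d}$-filters $F,G\subseteq A^1_+$, $$\inf_{a\in F}\sup_{b\in G}\mathbf{d}(a,b)=\inf_{a\in F}\sup_{b\in G}\mathbf{h}(a,b).$$
   Context: $A^1_+$ is the set of positive elements of $A$ of norm at most $1$. For $a,b\in A^1_+$, $\mathbf{d}(a,b)=\|a-ab\|$ and $\mathbf{h}(a,b)=\|(a-b)_+\|$, where $x_+$ is the positive part of a self-adjoint $x$. A subset $Y\subseteq A^1_+$ is a $\mathbf{d}$-filter if for all $a,b\in A^1_+$: ($a\in Y$ and $b\in Y$) $\Leftrightarrow$ $\inf_{c\in Y}(\mathbf{d}(c,b)+\mathbf{d}(c,a))=0$. Infima and suprema are taken in $[0,\infty]$. *)

(* Defs.v *)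
From HB Require Import structures.
From mathcomp Require Import all_boot all_order all_algebra.
From mathcomp Require Import all_classical all_reals all_analysis.
From mathcomp Require Export complex.
Import Order.TTheory GRing.Theory Num.Theory numFieldNormedType.Exports.

Set Implicit Arguments.
Unset Strict Implicit.
Unset Printing Implicit Defensive.

Local Open Scope classical_set_scope.
Local Open Scope ring_scope.
Local Open Scope complex_scope.

(* Complex C*-algebras, not assumed to have a unit: the ring structures of
   MathComp are all unital, hence a separate product [cmul].  The norm of the
   normed module takes its values in the nonnegative reals of R[i]. *)
HB.mixin Record isCStarAlgebra (R : realType) A
    of CompleteNormedModule R[i] A := {
  cmul : A -> A -> A ;
  cstar : A -> A ;
  cmulA : associative cmul ;
  cmulDl : left_distributive cmul +%R ;
  cmulDr : right_distributive cmul +%R ;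
  cmulZl : forall (k : R[i]) (x y : A), cmul (k *: x) y = k *: cmul x y ;
  cmulZr : forall (k : R[i]) (x y : A), cmul x (k *: y) = k *: cmul x y ;
  cnormM : forall x y : A, `|cmul x y| <= `|x| * `|y| ;
  cstarK : involutive cstar ;
  cstarD : {morph cstar : x y / x + y} ;
  cstarZ : forall (k : R[i]) (x : A), cstar (k *: x) = k^* *: cstar x ;
  cstarM : forall x y : A, cstar (cmul x y) = cmul (cstar y) (cstar x) ;
  cstar_identity : forall x : A, `|cmul (cstar x) x| = `|x| ^+ 2
}.

#[short(type="cstarAlgType")]
HB.structure Definition CStarAlgebra (R : realType) :=
  {A of isCStarAlgebra R A & CompleteNormedModule R[i] A}.

Section CStarAlgebraDefs.
Context {R : realType} {A : cstarAlgType R}.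
Implicit Types (a b x : A) (Y : set A).

(* The pair (k, x) is k1 + x in the unitization of A. *)
Definition unitization_mul (u v : R[i] * A) : R[i] * A :=
  (u.1 * v.1, u.1 *: v.2 + v.1 *: u.2 + cmul u.2 v.2).

Definition unitization_invertible (u : R[i] * A) : Prop :=
  exists v : R[i] * A,
    unitization_mul u v = (1, 0) /\ unitization_mul v u = (1, 0).

(* The spectrum is taken in the unitization.  If A already has a unit, this
   adds at most the point 0 to the spectrum computed in A, which is
   immaterial for positivity. *)
Definition spectrum x : set R[i] :=
  [set k | ~ unitization_invertible (k, - x)].

Definition selfadjoint x : Prop := cstar x = x.

(* In R[i], 0 <= k means that k is real and nonnegative. *)
Definition cpositive x : Prop :=
  selfadjoint x /\ forall k, spectrum x k -> 0 <= k.

(* A positive element has exactly one positive square root; [xget] selects it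
   (and returns 0 on elements without a positive square root). *)
Definition possqrt x : A := xget 0 [set b | cpositive b /\ cmul b b = x].

Definition cabs x : A := possqrt (cmul (cstar x) x).

Definition pospart x : A := 2^-1 *: (cabs x + x).

Definition cnorm x : R := complex.Re `|x|.

Definition pos_unit_ball : set A := [set a | cpositive a /\ cnorm a <= 1].

Definition dd a b : \bar R := (cnorm (a - cmul a b))%:E.

Definition hh a b : \bar R := (cnorm (pospart (a - b)))%:E.

(* Suprema in [0, +oo], where the supremum of the empty set is 0, whereas
   [ereal_sup set0 = -oo].  Infima in [0, +oo] of nonnegative families agree
   with [ereal_inf], including on the empty family. *)
Definition nneg_sup (S : set (\bar R)) : \bar R := maxe 0%E (ereal_sup S).

Definition dfilter Y : Prop :=
  Y `<=` pos_unit_ball /\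
  forall a b, pos_unit_ball a -> pos_unit_ball b ->
    (Y a /\ Y b <-> ereal_inf [set (dd c b + dd c a)%E | c in Y] = 0%E).

End CStarAlgebraDefs.

(* Main.v *)
Require Import Defs.
From HB Require Import structures.
From mathcomp Require Import all_boot all_order all_algebra.
From mathcomp Require Import all_classical all_reals all_analysis.
From mathcomp Require Import ring lra.
Import Order.TTheory GRing.Theory Num.Theory numFieldNormedType.Exports.

(* Everything takes place in the unitization of A, with elements identified with
   their images.  For a in F and b in G one may replace a by some p in F with
   p a close to p, and b by some f in G with f b close to f.
   - If p ~ p a and f ~ f b, then p <= a^2 and 1 - b <= (1 - f)^2 up to small
     errors, so p - b <= a^2 + (1 - f)^2 - 1 <= |a (1 - f)|, because the square
     of S = a^2 + c^2 is at most (1 + |a c|) S for contractions a, c >= 0.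
     Hence h(p, b) <= d(a, f) up to a small error.
   - Conversely let a - f <= t and put c = 1 - b, m = |p c|.  Compressing
     a - f <= t by w = p p c + m c, and using (a - f) p ~ (1 - f) p,
     (a - f) c ~ a c, gives m <= t up to a small error, i.e. d(p, b) <= h(a, f).
   The C*-algebraic input is elementary: a selfadjoint y with |y| = 1 has 1 or -1
   in its spectrum, for otherwise (1 - z)^-1 (1 - z^n) = \sum_(i < n) z^i would
   be bounded (z = y^2), whereas this sum has norm n. *)

Set Implicit Arguments.
Unset Strict Implicit.
Unset Printing Implicit Defensive.

Local Open Scope classical_set_scope.
Local Open Scope ring_scope.

(** * A normalizer for identities in noncommutative algebras *)

(** Between single elements [d] is not controlled by [h]: for the scalars a = b = 1/2 one has h = 0
    and d = 1/4. Hence both elements are moved inside their filters. The order of the choices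
    matters: p depends on a and the tolerance alone, whereas f is chosen in G after b, and the
    assumed bound on the supremum over G is applied to f. No functional calculus is developed.
    Positivity means selfadjointness together with invertibility of all shifts by positive reals,
    and an order relation is proved by displaying the difference as a sum of squares, of conjugates
    of positive elements and of terms [t%:A - x] with N x <= t. The normalizer checks the resulting
    polynomial identities in noncommuting variables. In the second half the error is not linear: [w]
    has norm at most 2 m, so the estimate reads m^2 (m - t) <= 5 e, and a final tolerance e requires
    approximations of order e^3. *)

Inductive nc_expr (K : Type) :=
  NCvar of nat | NCone | NCzero | NCadd of nc_expr K & nc_expr K
| NCopp of nc_expr K | NCmul of nc_expr K & nc_expr K
| NCscale of K & nc_expr K.

(** Built on [Nat.eqb] so that the explicit unfolding list in [nc_ring_simplify] decides equality of
    words while leaving the coefficients unevaluated. *)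
Fixpoint nc_eqw (u v : seq nat) : bool :=
  match u, v with
  | [::], [::] => true
  | i :: u', j :: v' => if Nat.eqb i j then nc_eqw u' v' else false
  | _, _ => false
  end.

Lemma nc_eqwP u v : nc_eqw u v -> u = v.
Proof.
elim: u v => [|i u IH] [|j v] //=.
by case: (PeanoNat.Nat.eqb_spec i j) => // -> /IH ->.
Qed.

Section Normalizer.
Variables (K : comNzRingType) (U : algType K).
Implicit Types (env : seq U) (m : seq nat * K) (l : seq (seq nat * K)).

Fixpoint nc_eval env (e : nc_expr K) : U :=
  match e with
  | NCvar i => nth 0 env i
  | NCone => 1
  | NCzero => 0
  | NCadd e1 e2 => nc_eval env e1 + nc_eval env e2
  | NCopp e1 => - nc_eval env e1
  | NCmul e1 e2 => nc_eval env e1 * nc_eval env e2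
  | NCscale k e1 => k *: nc_eval env e1
  end.

Fixpoint nc_insert m l :=
  if l is m' :: l' then
    if nc_eqw m.1 m'.1 then (m'.1, m.2 + m'.2) :: l' else m' :: nc_insert m l'
  else [:: m].

Fixpoint nc_sum l1 l2 :=
  if l1 is m :: l then nc_insert m (nc_sum l l2) else l2.

Fixpoint nc_scale m l :=
  if l is m' :: l' then (m.1 ++ m'.1, m.2 * m'.2) :: nc_scale m l' else [::].

Fixpoint nc_prod l1 l2 :=
  if l1 is m :: l then nc_sum (nc_scale m l2) (nc_prod l l2) else [::].

Fixpoint nc_norm (e : nc_expr K) : seq (seq nat * K) :=
  match e with
  | NCvar i => [:: ([:: i], 1)]
  | NCone => [:: ([::], 1)]
  | NCzero => [::]
  | NCadd e1 e2 => nc_sum (nc_norm e1) (nc_norm e2)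
  | NCopp e1 => nc_scale ([::], -1) (nc_norm e1)
  | NCmul e1 e2 => nc_prod (nc_norm e1) (nc_norm e2)
  | NCscale k e1 => nc_scale ([::], k) (nc_norm e1)
  end.

Definition nc_word env (w : seq nat) : U := \prod_(i <- w) nth 0 env i.

Definition nc_value env l : U := \sum_(m <- l) m.2 *: nc_word env m.1.

(** Coefficients are never tested for zero during normalization; they end up in this conjunction of
    equations in [K], left to [ring] or [field]. *)
Fixpoint nc_null l : Prop :=
  if l is m :: l' then m.2 = 0 /\ nc_null l' else True.

Lemma nc_value_cons env m l :
  nc_value env (m :: l) = m.2 *: nc_word env m.1 + nc_value env l.
Proof. by rewrite /nc_value big_cons. Qed.

Lemma nc_value_insert env m l :
  nc_value env (nc_insert m l) = m.2 *: nc_word env m.1 + nc_value env l.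
Proof.
elim: l => [|m' l IH] /=; first by rewrite nc_value_cons.
case: ifP => [/nc_eqwP e|_]; rewrite !nc_value_cons /=.
  by rewrite e scalerDl addrA.
by rewrite IH addrCA.
Qed.

Lemma nc_value_sum env l1 l2 :
  nc_value env (nc_sum l1 l2) = nc_value env l1 + nc_value env l2.
Proof.
elim: l1 => [|m l IH] /=; first by rewrite /nc_value big_nil add0r.
by rewrite nc_value_insert IH nc_value_cons addrA.
Qed.

Lemma nc_value_scale env m l :
  nc_value env (nc_scale m l) = (m.2 *: nc_word env m.1) * nc_value env l.
Proof.
elim: l => [|m' l IH] /=; first by rewrite /nc_value big_nil mulr0.
rewrite !nc_value_cons IH mulrDr /nc_word big_cat /=.
by rewrite -!scalerAl -!scalerAr !scalerA.
Qed.

Lemma nc_value_prod env l1 l2 :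
  nc_value env (nc_prod l1 l2) = nc_value env l1 * nc_value env l2.
Proof.
elim: l1 => [|m l IH] /=; first by rewrite /nc_value big_nil mul0r.
by rewrite nc_value_sum nc_value_scale IH nc_value_cons mulrDl.
Qed.

Lemma nc_value_norm env e : nc_value env (nc_norm e) = nc_eval env e.
Proof.
elim: e => [i|||e1 IH1 e2 IH2|e IH|e1 IH1 e2 IH2|k e IH] /=.
- by rewrite nc_value_cons /nc_value /nc_word big_nil big_seq1 scale1r addr0.
- by rewrite nc_value_cons /nc_value /nc_word !big_nil scale1r addr0.
- by rewrite /nc_value big_nil.
- by rewrite nc_value_sum IH1 IH2.
- by rewrite nc_value_scale IH /nc_word big_nil scaleN1r mulN1r.
- by rewrite nc_value_prod IH1 IH2.
- by rewrite nc_value_scale IH /nc_word big_nil -scalerAl mul1r.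
Qed.

Lemma nc_sound env e1 e2 :
  nc_null (nc_norm (NCadd e1 (NCopp e2))) -> nc_eval env e1 = nc_eval env e2.
Proof.
move=> h; apply/eqP; rewrite -subr_eq0; apply/eqP.
rewrite -[LHS]/(nc_eval env (NCadd e1 (NCopp e2))) -nc_value_norm.
elim: (nc_norm _) h => [|m l IH] /=; first by rewrite /nc_value big_nil.
by case=> m0 /IH; rewrite nc_value_cons m0 scale0r add0r.
Qed.

End Normalizer.

Ltac nc_index x env :=
  lazymatch env with
  | x :: _ => constr:(O)
  | _ :: ?env' => let n := nc_index x env' in constr:(S n)
  end.

Ltac nc_atoms t env :=
  lazymatch t with
  | @GRing.zero _ => env
  | @GRing.one _ => env
  | @GRing.add _ ?a ?b => let env' := nc_atoms a env in nc_atoms b env'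
  | @GRing.mul _ ?a ?b => let env' := nc_atoms a env in nc_atoms b env'
  | @GRing.opp _ ?a => nc_atoms a env
  | @GRing.scale _ _ _ ?a => nc_atoms a env
  | _ => lazymatch env with
         | context [t :: _] => env
         | _ => constr:(t :: env)
         end
  end.

Ltac nc_reify K t env :=
  lazymatch t with
  | @GRing.zero _ => constr:(@NCzero K)
  | @GRing.one _ => constr:(@NCone K)
  | @GRing.add _ ?a ?b =>
      let a' := nc_reify K a env in let b' := nc_reify K b env in
      constr:(@NCadd K a' b')
  | @GRing.mul _ ?a ?b =>
      let a' := nc_reify K a env in let b' := nc_reify K b env in
      constr:(@NCmul K a' b')
  | @GRing.opp _ ?a => let a' := nc_reify K a env in constr:(@NCopp K a')
  | @GRing.scale _ _ ?k ?a =>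
      let a' := nc_reify K a env in constr:(@NCscale K k a')
  | _ => let i := nc_index t env in constr:(@NCvar K i)
  end.

Ltac nc_ring_simplify K U :=
  lazymatch goal with |- ?a = ?b =>
    let env0 := nc_atoms a (@nil (GRing.Algebra.sort U)) in
    let env := nc_atoms b env0 in
    let ea := nc_reify (GRing.ComNzRing.sort K) a env in
    let eb := nc_reify (GRing.ComNzRing.sort K) b env in
    apply: (@nc_sound K U env ea eb);
    cbv [nc_norm nc_sum nc_insert nc_scale nc_prod nc_null nc_eqw Nat.eqb
         cat fst snd]
  end.

(** * Unital C*-algebras *)

(* The scalars are real; multiplication by the complex unit is the central
   element [uI]. *)
HB.mixin Record isUnitalCStar (R : realType) U of GRing.Algebra R U := {
  uI : U ;
  ustar : U -> U ;
  unorm : U -> R ;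
  uI_sqr : uI * uI = -1 ;
  uI_comm : forall x : U, uI * x = x * uI ;
  ustarI : ustar uI = - uI ;
  ustarK : involutive ustar ;
  ustarD : {morph ustar : x y / x + y} ;
  ustarZ : forall (k : R) (x : U), ustar (k *: x) = k *: ustar x ;
  ustarM : forall x y : U, ustar (x * y) = ustar y * ustar x ;
  unormD : forall x y : U, unorm (x + y) <= unorm x + unorm y ;
  unormZ : forall (k : R) (x : U), unorm (k *: x) = `|k| * unorm x ;
  unormM : forall x y : U, unorm (x * y) <= unorm x * unorm y ;
  unorm_star_ge : forall x : U, unorm x ^+ 2 <= unorm (ustar x * x) ;
  unorm_eq0 : forall x : U, unorm x = 0 -> x = 0 ;
  unorm_complete : forall u : nat -> U,
    (forall e : R, 0 < e -> exists n : nat, forall m : nat,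
      (n <= m)%N -> unorm (u m - u n) <= e) ->
    exists l : U, forall e : R, 0 < e -> exists n : nat, forall m : nat,
      (n <= m)%N -> unorm (u m - l) <= e
}.

#[short(type="ucstarType")]
HB.structure Definition UnitalCStar (R : realType) :=
  {U of isUnitalCStar R U & GRing.Algebra R U}.

Section UnitalCStarTheory.
Context {R : realType} {U : ucstarType R}.
Implicit Types (x y z a b c s : U) (k t d : R).

Local Notation N := (@unorm R U).
Local Notation "x ^†" := (ustar x) (at level 2, format "x ^†").
Local Notation uI := (@uI R U).

Local Ltac nc := nc_ring_simplify R U; repeat split; first [ring | by field].

Lemma ustar0 : (0 : U)^† = 0.
Proof. by rewrite -(scale0r 0) ustarZ !scale0r. Qed.

Lemma ustarN x : (- x)^† = - x^†.
Proof. by rewrite -scaleN1r ustarZ scaleN1r. Qed.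

Lemma ustarB x y : (x - y)^† = x^† - y^†.
Proof. by rewrite ustarD ustarN. Qed.

Lemma ustar1 : (1 : U)^† = 1.
Proof. by rewrite -[RHS]ustarK -[in RHS](mulr1 (1^†)) ustarM ustarK mulr1. Qed.

Lemma unorm0 : N 0 = 0.
Proof. by rewrite -(scale0r 0) unormZ normr0 mul0r. Qed.

Lemma unormN x : N (- x) = N x.
Proof. by rewrite -scaleN1r unormZ normrN1 mul1r. Qed.

Lemma unormB x y : N (x - y) <= N x + N y.
Proof. by rewrite -(unormN y) unormD. Qed.

Lemma unormBC x y : N (x - y) = N (y - x).
Proof. by rewrite -unormN opprB. Qed.

Lemma unorm_ge0 x : 0 <= N x.
Proof. by have := unormB x x; rewrite subrr unorm0; lra. Qed.

Lemma unorm_gt0 x : x != 0 -> 0 < N x.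
Proof.
by move=> x0; rewrite lt0r unorm_ge0 andbT; apply: contraNneq x0 => /unorm_eq0 ->.
Qed.

Lemma unorm_star x : N x^† = N x.
Proof.
suff h y : N y <= N y^† by apply/eqP; rewrite eq_le h -{2}(ustarK x) h.
have [->|/unorm_gt0 y0] := eqVneq y 0; first by rewrite ustar0.
by rewrite -(ler_pM2r y0) -expr2 (le_trans (unorm_star_ge y)) ?unormM.
Qed.

Lemma unormS x : N (x^† * x) = N x ^+ 2.
Proof.
apply/eqP; rewrite eq_le unorm_star_ge andbT.
by rewrite (le_trans (unormM _ _)) // unorm_star.
Qed.

Lemma unorm1 : N 1 = 1.
Proof.
have := unormS 1; rewrite ustar1 mulr1 => h.
have n0 : N 1 != 0 by rewrite gt_eqF // unorm_gt0 ?oner_neq0.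
by apply: (mulfI n0); rewrite mulr1 -expr2 -h.
Qed.

Lemma unormA k : N k%:A = `|k|.
Proof. by rewrite unormZ unorm1 mulr1. Qed.

Lemma unormI_le x : N (uI * x) <= N x.
Proof.
have : N uI ^+ 2 = 1.
  by rewrite -unormS ustarI mulNr uI_sqr opprK unorm1.
move=> /eqP; rewrite sqrf_eq1 => /orP[]/eqP nI.
  by rewrite (le_trans (unormM _ _)) // nI mul1r.
by have := unorm_ge0 uI; rewrite nI; lra.
Qed.

Lemma unorm_le_eq0 x (C : R) : (forall d, 0 < d -> N x <= C * d) -> x = 0.
Proof.
move=> h; apply: unorm_eq0; apply/eqP; rewrite eq_le unorm_ge0 andbT.
apply/ler_addgt0Pr => e e0; rewrite add0r.
have C0 : 0 < `|C| + 1 by rewrite ltr_pwDr.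
apply: (le_trans (h _ (divr_gt0 e0 C0))).
rewrite mulrA ler_pdivrMr // mulrC ler_pM2l //.
by have := ler_norm C; lra.
Qed.

(** Majorant principle: [r] is nondecreasing and bounded, and from an index where [r] is within e of
    its supremum on, [u] moves by at most e. It serves the geometric series and the square root
    iteration, each majorized by the same recursion on scalars. *)
Lemma unorm_bounded_variation (u : nat -> U) (r : nat -> R) (M : R) :
  (forall n, N (u n.+1 - u n) <= r n.+1 - r n) -> (forall n, r n <= M) ->
  exists l, forall e, 0 < e -> exists n, forall m,
    (n <= m)%N -> N (u m - l) <= e.
Proof.
move=> ur rM; apply: unorm_complete => e e0.
have hs : has_sup (range r).
  by split; [exists (r 0%N), 0%N | exists M => _ [n _ <-]].
have [_ [n _ <-] rn] := sup_adherent e0 hs.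
exists n => m /subnK <-; rewrite addnC.
suff h i : N (u (n + i)%N - u n) <= r (n + i)%N - r n.
  apply: (le_trans (h _)).
  have : r (n + (m - n))%N <= sup (range r).
    by apply: ub_le_sup; [exact: hs.2 | exists (n + (m - n))%N].
  by lra.
elim: i => [|i IH]; first by rewrite addn0 !subrr unorm0.
rewrite addnS -(subrKA (u (n + i)%N)) (le_trans (unormD _ _)) //.
by have := ur (n + i)%N; lra.
Qed.

Definition uinv x := exists y, x * y = 1 /\ y * x = 1.

Lemma uinv_lr x y z : x * y = 1 -> z * x = 1 -> uinv x.
Proof.
move=> xy zx; exists y; split=> //.
by rewrite -[y]mul1r -zx -(mulrA z) xy mulr1.
Qed.


Lemma uinvM x y : uinv x -> uinv y -> uinv (x * y).
Proof.
move=> [x' [xx' x'x]] [y' [yy' y'y]]; exists (y' * x'); split.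
  by rewrite mulrA -(mulrA x) yy' mulr1.
by rewrite mulrA -(mulrA y') x'x mulr1.
Qed.

Lemma uinv_comm_factor x y : x * y = y * x -> uinv (x * y) -> uinv x.
Proof.
move=> c [w [h1 h2]]; apply: (@uinv_lr _ (y * w) (w * y)); first by rewrite mulrA.
by rewrite -mulrA -c.
Qed.

Lemma uinvZ k x : k != 0 -> uinv x -> uinv (k *: x).
Proof.
move=> k0 [y [xy yx]]; exists (k^-1 *: y).
by rewrite -!scalerAl -!scalerAr !scalerA xy yx mulfV // mulVf // scale1r.
Qed.

Lemma uinvN x : uinv (- x) -> uinv x.
Proof.
by move=> /(@uinvZ (-1) _ _); rewrite scaleN1r opprK oppr_eq0 oner_eq0; apply.
Qed.

Lemma uinv0 : ~ uinv 0.
Proof. by case=> y []; rewrite mul0r => /esym/eqP; rewrite oner_eq0. Qed.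

Lemma uinv_I : uinv uI.
Proof. by exists (- uI); rewrite mulrN mulNr uI_sqr opprK. Qed.

Lemma uinv_neumann x : N x < 1 -> uinv (1 - x).
Proof.
move=> x1; have x0 := unorm_ge0 x.
(* Partial sums of the geometric series, those for [N x] being the majorant. The recursion [uC] with
   [x] on the right makes the limit a two-sided inverse. *)
pose u n : U := iter n (fun y => 1 + x * y) 0.
pose r n : R := iter n (fun t => 1 + N x * t) 0.
have uS n : u n.+1 = 1 + x * u n by [].
have rS n : r n.+1 = 1 + N x * r n by [].
have uC n : u n.+1 = 1 + u n * x.
  elim: n => [|n IH]; first by rewrite uS /= mulr0 mul0r.
  by rewrite uS {1}IH uS; nc.
have [l lu] : exists l, forall e, 0 < e -> exists n, forall m,
    (n <= m)%N -> N (u m - l) <= e.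
  apply: (@unorm_bounded_variation u r (1 - N x)^-1) => n.
    elim: n => [|n IH]; first by rewrite uS rS /= !mulr0 !addr0 !subr0 unorm1.
    have -> : u n.+2 - u n.+1 = x * (u n.+1 - u n) by rewrite !(uS n.+1, uS n); nc.
    rewrite (le_trans (unormM _ _)) // (le_trans (ler_wpM2l _ IH)) //.
    by rewrite [X in _ <= X - _]rS [X in _ <= _ - X]rS; lra.
  rewrite -[X in _ <= X]mul1r ler_pdivlMr ?subr_gt0 //.
  elim: n => [|n IH]; first by rewrite mul0r ler01.
  rewrite rS; have : N x * (r n * (1 - N x)) <= N x by rewrite ler_piMr.
  by lra.
exists l; split; apply/eqP; rewrite -subr_eq0; apply/eqP;
  apply: (@unorm_le_eq0 _ 2) => e e0;
  have [n hn] := lu _ e0; have a1 := hn _ (leqnn n); have a2 := hn _ (leqnSn n).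
- have -> : (1 - x) * l - 1 = x * (u n - l) - (u n.+1 - l) by rewrite uS; nc.
  rewrite (le_trans (unormB _ _)) //.
  have := le_trans (unormM x (u n - l)) (ler_wpM2r (unorm_ge0 _) (ltW x1)).
  by lra.
- have -> : l * (1 - x) - 1 = (u n - l) * x - (u n.+1 - l) by rewrite uC; nc.
  rewrite (le_trans (unormB _ _)) //.
  have := le_trans (unormM (u n - l) x) (ler_wpM2l (unorm_ge0 _) (ltW x1)).
  by lra.
Qed.

Lemma uinv_scalar_sub t x : N x < t -> uinv (t%:A - x).
Proof.
move=> xt; have t0 : 0 < t := le_lt_trans (unorm_ge0 x) xt.
have -> : t%:A - x = t *: (1 - t^-1 *: x).
  by rewrite scalerBr scalerA mulfV ?gt_eqF // scale1r.
apply: uinvZ; first by rewrite gt_eqF.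
apply: uinv_neumann; rewrite unormZ ger0_norm ?invr_ge0 ?ltW //.
by rewrite mulrC ltr_pdivrMr // mul1r.
Qed.

Definition usa x := x^† = x.

Lemma usaD x y : usa x -> usa y -> usa (x + y).
Proof. by rewrite /usa ustarD => -> ->. Qed.

Lemma usaN x : usa x -> usa (- x).
Proof. by rewrite /usa ustarN => ->. Qed.

Lemma usaB x y : usa x -> usa y -> usa (x - y).
Proof. by move=> hx /usaN; apply: usaD. Qed.

Lemma usaZ k x : usa x -> usa (k *: x).
Proof. by rewrite /usa ustarZ => ->. Qed.

Lemma usa1 : usa 1. Proof. exact: ustar1. Qed.

Lemma usaM x y : usa x -> usa y -> x * y = y * x -> usa (x * y).
Proof. by rewrite /usa ustarM => -> ->. Qed.

Lemma usaA k : usa k%:A. Proof. exact: (usaZ _ usa1). Qed.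

Lemma usa_sqr x : usa x -> usa (x * x).
Proof. by move=> h; apply: usaM. Qed.

Lemma usa_starM x : usa (x^† * x).
Proof. by rewrite /usa ustarM ustarK. Qed.

Lemma usa_conj x c : usa x -> usa (c^† * x * c).
Proof. by rewrite /usa !ustarM ustarK => ->; rewrite mulrA. Qed.

Lemma unorm_sqr x : usa x -> N (x * x) = N x ^+ 2.
Proof. by move=> xs; rewrite -unormS xs. Qed.

Lemma ustar_addI x t : usa x -> (x + t *: uI)^† = x - t *: uI.
Proof. by move=> xs; rewrite ustarD ustarZ ustarI xs scalerN. Qed.

Lemma mul_addI x t d : (x + t *: uI) * (x + d *: uI) =
  x * x - (t * d)%:A + (t + d) *: (uI * x).
Proof.
transitivity (x * x + d *: (x * uI) + t *: (uI * x) + (t * d) *: (uI * uI)).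
  by nc.
by rewrite -uI_comm uI_sqr; nc.
Qed.

Lemma unorm_addI x t : usa x -> N (x + t *: uI) ^+ 2 = N (x * x + (t ^+ 2)%:A).
Proof.
move=> xs; rewrite -unormS ustar_addI // -scaleNr mul_addI addrC addrA.
by rewrite addNr scale0r add0r mulNr scaleNr opprK expr2.
Qed.

(** Shift along the imaginary axis: y + e i = i ((e + T) - i (y - T i)), and N (y - T i)^2 <= N y^2
    + T^2 is smaller than (e + T)^2 as soon as 2 e T >= N y^2. The chosen [T] gives equality in the
    last condition. *)
Lemma uinv_sa_addI x d : usa x -> d != 0 -> uinv (x + d *: uI).
Proof.
suff h (e : R) y : 0 < e -> usa y -> uinv (y + e *: uI).
  move=> xs d0; have [dp|dn|d00] := ltgtP 0 d; first exact: h.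
    by apply: uinvN; rewrite opprD -scaleNr; apply: h (usaN xs); rewrite oppr_gt0.
  by rewrite -d00 eqxx in d0.
move=> e0 ys; pose T := N y ^+ 2 / (2 * e).
have T0 : 0 <= T by rewrite divr_ge0 ?exprn_ge0 ?unorm_ge0 // mulr_ge0 // ltW.
have h : uinv ((e + T)%:A - uI * (y - T *: uI)).
  apply: uinv_scalar_sub; apply: (le_lt_trans (unormI_le _)).
  rewrite -(@ltr_pXn2r _ 2) // ?nnegrE ?unorm_ge0 ?addr_ge0 ?(ltW e0) //.
  rewrite -scaleNr unorm_addI // sqrrN; apply: (le_lt_trans (unormD _ _)).
  rewrite unormA ger0_norm ?sqr_ge0 // unorm_sqr //.
  have -> : (e + T) ^+ 2 = e ^+ 2 + N y ^+ 2 + T ^+ 2.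
    by rewrite /T; field; lra.
  by have := exprn_gt0 2 e0; lra.
have -> : y + e *: uI = uI * ((e + T)%:A - uI * (y - T *: uI)); last first.
  by apply: uinvM h; exact: uinv_I.
transitivity ((e + T) *: uI - (uI * uI) * (y - T *: uI)); last by nc.
by rewrite uI_sqr; nc.
Qed.

End UnitalCStarTheory.

(** * Positive elements *)

Section Positivity.
Context {R : realType} {U : ucstarType R}.
Implicit Types (x y z a b c s : U) (k t d : R).

Local Notation N := (@unorm R U).
Local Notation "x ^†" := (ustar x) (at level 2, format "x ^†").
Local Notation uI := (@uI R U).

Local Ltac nc := nc_ring_simplify R U; repeat split; first [ring | by field].

Lemma usaX x n : usa x -> usa (x ^+ n).
Proof.
move=> xs; elim: n => [|n IH]; first by rewrite expr0; exact: usa1.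
by rewrite exprS; apply: usaM => //; rewrite -exprS -exprSr.
Qed.

Lemma unormX2 x n : usa x -> N (x ^+ (2 ^ n)) = N x ^+ (2 ^ n).
Proof.
move=> xs; elim: n => [|n IH]; first by rewrite !expr1.
rewrite expnS mul2n -addnn !exprD unorm_sqr ?IH ?expr2 //.
exact: usaX.
Qed.

Lemma unorm_sum (I : Type) (r : seq I) (F : I -> U) :
  N (\sum_(i <- r) F i) <= \sum_(i <- r) N (F i).
Proof.
elim: r => [|i r IH]; first by rewrite !big_nil unorm0.
by rewrite !big_cons (le_trans (unormD _ _)) // lerD2l.
Qed.

Lemma unormX_le1 x n : N x <= 1 -> N (x ^+ n) <= 1.
Proof.
move=> x1; elim: n => [|n IH]; first by rewrite expr0 unorm1.
by rewrite exprS (le_trans (unormM _ _)) // mulr_ile1 ?unorm_ge0.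
Qed.

Lemma unormI x : N (uI * x) = N x.
Proof.
apply/eqP; rewrite eq_le unormI_le /=.
by rewrite -[in X in X <= _](unormN x) -mulN1r -uI_sqr -mulrA unormI_le.
Qed.

(* From [4 i y = (y + i)^2 - (y - i)^2] and [N (y +- i) ^+ 2 = N (1 + y^2)]. *)
Lemma unorm_1Dsqr_ge2 y : usa y -> N y = 1 -> 2 <= N (1 + y * y).
Proof.
move=> ys y1; pose p := y + 1 *: uI; pose q := y + (-1) *: uI.
have e : 4 *: (uI * y) = p * p - q * q by rewrite !mul_addI; nc.
have e4 : 4 = N (p * p - q * q) by rewrite -e unormZ unormI y1 mulr1 gtr0_norm.
have np : N p ^+ 2 = N (1 + y * y).
  by rewrite unorm_addI // expr1n scale1r addrC.
have nq : N q ^+ 2 = N (1 + y * y).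
  by rewrite unorm_addI // sqrrN expr1n scale1r addrC.
have := unormB (p * p) (q * q); rewrite -e4.
have := unormM p p; have := unormM q q; rewrite -!expr2 np nq.
by lra.
Qed.

(* [(1 + z)^n - \sum_(i <= n) z^i] has nonnegative integer coefficients, with
   sum [2^n - (n + 1)]. *)
Lemma unorm_geometric_ge z n : N z <= 1 -> 2 ^+ n <= N ((1 + z) ^+ n) ->
  n.+1%:R <= N (\sum_(i < n.+1) z ^+ i).
Proof.
move=> z1 h.
have e : (1 + z) ^+ n =
    \sum_(i < n.+1) z ^+ i + \sum_(i < n.+1) z ^+ i *+ ('C(n, i) - 1).
  rewrite exprDn_comm; last by rewrite /GRing.comm mul1r mulr1.
  rewrite -big_split /=; apply: eq_bigr => i _.
  rewrite expr1n mul1r -mulrS -subSn ?subn1 //.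
  by rewrite bin_gt0 -ltnS ltn_ord.
have s : N (\sum_(i < n.+1) z ^+ i *+ ('C(n, i) - 1)) <= 2 ^+ n - n.+1%:R.
  apply: (le_trans (unorm_sum _ _)).
  apply: (@le_trans _ _ (\sum_(i < n.+1) ('C(n, i)%:R - 1 : R))).
    apply: ler_sum => i _; rewrite -scaler_nat unormZ.
    have i1 : (0 < 'C(n, i))%N by rewrite bin_gt0 -ltnS ltn_ord.
    rewrite natrB // ger0_norm ?subr_ge0 ?ler1n // ler_piMr ?unormX_le1 //.
    by rewrite subr_ge0 ler1n.
  rewrite big_split /= sumr_const card_ord -natr_sum mulNrn.
  have -> : (\sum_(i < n.+1) 'C(n, i))%N = (2 ^ n)%N.
    rewrite -[2%N]/(1 + 1)%N expnDn; apply: eq_bigr => i _.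
    by rewrite !exp1n !muln1.
  by rewrite natrX.
have := le_trans h _; rewrite e => /(_ _ (unormD _ _)).
by lra.
Qed.

Lemma not_uinv_1Bsqr y : usa y -> N y = 1 -> ~ uinv (1 - y * y).
Proof.
move=> ys y1 [g [_ gl]].
have z1 : N (y * y) = 1 by rewrite unorm_sqr // y1 expr1n.
have g0 := unorm_ge0 g.
(* The exponent is a power of two because the C*-identity gives N (x^n) = N x^n for selfadjoint x by
   repeated squaring; [k] already exceeds 2 N g, the bound for the geometric sum. *)
pose k := Num.bound (N g * 2); pose n := (2 ^ k)%N.
have h : n.+1%:R <= N (\sum_(i < n.+1) (y * y) ^+ i).
  apply: unorm_geometric_ge; first by rewrite z1.
  rewrite unormX2; last by apply: usaD; [exact: usa1 | exact: usa_sqr].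
  apply: lerXn2r; rewrite ?nnegrE ?unorm_ge0 //; exact: unorm_1Dsqr_ge2.
have e : \sum_(i < n.+1) (y * y) ^+ i = g * (1 - (y * y) ^+ n.+1).
  by rewrite -[1 - _ ^+ _]opprB subrX1 -mulNr opprB mulrA gl mul1r.
have : N (g * (1 - (y * y) ^+ n.+1)) <= N g * 2.
  apply: (le_trans (unormM _ _)); apply: ler_wpM2l => //.
  apply: (le_trans (unormB _ _)); rewrite unorm1.
  have : N ((y * y) ^+ n.+1) <= 1 by rewrite unormX_le1 ?z1.
  by lra.
rewrite -e => /(le_trans h); have := archi_boundP (mulr_ge0 g0 (ler0n _ 2)).
rewrite -/k => h1 h2.
suff kn : k%:R <= (n.+1)%:R :> R.
  by have := le_lt_trans (le_trans kn h2) h1; rewrite ltxx.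
by rewrite ler_nat ltnW // ltnS ltnW // ltn_expl.
Qed.

(** After scaling to norm 1 the product of the two factors is 1 - y^2. This stands in for the
    equality of norm and spectral radius of selfadjoint elements: norm bounds are extracted from
    invertibility through it. *)
Lemma unorm_not_uinv y :
  usa y -> uinv ((N y)%:A - y) -> uinv ((N y)%:A + y) -> False.
Proof.
move=> ys; have [->|y0] := eqVneq y 0.
  by rewrite unorm0 scale0r subr0 => /uinv0.
have n0 := unorm_gt0 y0; move=> h1 h2.
apply: (@not_uinv_1Bsqr ((N y)^-1 *: y)); first exact: usaZ.
  by rewrite unormZ ger0_norm ?invr_ge0 ?ltW // mulVf ?gt_eqF.
have -> : 1 - (N y)^-1 *: y * ((N y)^-1 *: y) =
    (N y) ^- 2 *: (((N y)%:A - y) * ((N y)%:A + y)).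
  nc_ring_simplify R U; repeat split; try ring; field; rewrite gt_eqF //.
by apply: uinvZ; [|exact: uinvM]; rewrite invr_eq0 expf_eq0 /= gt_eqF.
Qed.

(** The spectrum is asked to avoid the negative reals; nonreal numbers are excluded by
    [uinv_sa_addI]. *)
Definition upos x := usa x /\ forall d, 0 < d -> uinv (x + d%:A).


(** With [upos_unorm] this describes positivity by a norm inequality, which, unlike the spectral
    condition, is visibly stable under sums. *)
Lemma upos_unorm_sub x : upos x -> N ((N x)%:A - x) <= N x.
Proof.
move=> [xs xp]; rewrite leNgt; apply/negP => h.
set y := (N x)%:A - x in h *.
have ys : usa y by apply: usaB => //; exact: usaA.
apply: (unorm_not_uinv ys).
  have -> : (N y)%:A - y = x + (N y - N x)%:A by rewrite /y; nc.
  by apply: xp; rewrite subr_gt0.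
have -> : (N y)%:A + y = (N y + N x)%:A - x by rewrite /y; nc.
by apply: uinv_scalar_sub; have := unorm_ge0 x; lra.
Qed.

Lemma upos_unorm x t : usa x -> N (t%:A - x) <= t -> upos x.
Proof.
move=> xs h; split=> // d d0.
have -> : x + d%:A = (t + d)%:A - (t%:A - x) by nc.
by apply: uinv_scalar_sub; lra.
Qed.

Lemma uposD x y : upos x -> upos y -> upos (x + y).
Proof.
move=> xp yp; apply: (@upos_unorm _ (N x + N y)).
  by apply: usaD; [exact: xp.1 | exact: yp.1].
have -> : (N x + N y)%:A - (x + y) = ((N x)%:A - x) + ((N y)%:A - y) by nc.
by rewrite (le_trans (unormD _ _)) // lerD // upos_unorm_sub.
Qed.

Lemma uposZ k x : 0 <= k -> upos x -> upos (k *: x).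
Proof.
move=> k0 xp; apply: (@upos_unorm _ (k * N x)); first exact: usaZ xp.1.
have -> : (k * N x)%:A - k *: x = k *: ((N x)%:A - x) by nc.
by rewrite unormZ ger0_norm // ler_wpM2l // upos_unorm_sub.
Qed.

Lemma uposA k : 0 <= k -> upos k%:A.
Proof.
move=> k0; apply: uposZ => //; apply: (@upos_unorm _ 1); first exact: usa1.
by rewrite scale1r subrr unorm0.
Qed.

Lemma upos0 : upos 0.
Proof. by rewrite -(scale0r 1); exact: uposA. Qed.

Lemma upos_scalar_sub t x : usa x -> N x <= t -> upos (t%:A - x).
Proof.
move=> xs h; apply: (@upos_unorm _ t); first by apply: usaB => //; exact: usaA.
by rewrite opprB addrC subrK.
Qed.

Lemma unorm_upos_le x t : 0 <= t -> upos x -> upos (t%:A - x) -> N x <= t.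
Proof.
move=> t0 [xs xp] [_ tp]; rewrite leNgt; apply/negP => h.
apply: (unorm_not_uinv xs).
  have -> : (N x)%:A - x = (t%:A - x) + (N x - t)%:A by nc.
  by apply: tp; rewrite subr_gt0.
by rewrite addrC; apply: xp; exact: le_lt_trans h.
Qed.

Lemma upos_anti x : upos x -> upos (- x) -> x = 0.
Proof.
move=> xp nxp; apply: unorm_eq0; apply/eqP; rewrite eq_le unorm_ge0 andbT.
by apply: unorm_upos_le => //; rewrite scale0r sub0r.
Qed.

Lemma upos_sqr x : usa x -> upos (x * x).
Proof.
move=> xs; split=> [|d d0]; first exact: usa_sqr.
have d0' : Num.sqrt d != 0 by rewrite sqrtr_eq0 -ltNge.
have -> : x * x + d%:A = (x + Num.sqrt d *: uI) * (x + (- Num.sqrt d) *: uI).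
  by rewrite mul_addI mulrN -[Num.sqrt d * _]expr2 sqr_sqrtr ?ltW //; nc.
by apply: uinvM; apply: uinv_sa_addI; rewrite ?oppr_eq0.
Qed.

End Positivity.

(** * Square roots, positive and negative parts, positivity of [y^† * y] *)

Section SquareRoots.
Context {R : realType} {U : ucstarType R}.
Implicit Types (x y z b c e f h s : U) (k t d : R).

Local Notation N := (@unorm R U).
Local Notation "x ^†" := (ustar x) (at level 2, format "x ^†").
Local Notation uI := (@uI R U).

Local Ltac nc := nc_ring_simplify R U; repeat split; first [ring | by field].

Lemma unorm_lim_comm (u : nat -> U) x c :
  (forall d, 0 < d -> exists n, N (u n - x) <= d) ->
  (forall n, c * u n = u n * c) -> c * x = x * c.
Proof.
move=> ux uc; apply/eqP; rewrite -subr_eq0; apply/eqP.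
apply: (@unorm_le_eq0 _ _ _ (2 * N c)) => d /ux [n hn].
have -> : c * x - x * c = (u n - x) * c - c * (u n - x).
  by rewrite mulrBr mulrBl (uc n); nc.
rewrite (le_trans (unormB _ _)) //.
have h1 := unormM (u n - x) c; have h2 := unormM c (u n - x).
have c0 := unorm_ge0 c; have := ler_wpM2l c0 hn; lra.
Qed.

Lemma unorm_lim_sa (u : nat -> U) x :
  (forall d, 0 < d -> exists n, N (u n - x) <= d) ->
  (forall n, usa (u n)) -> usa x.
Proof.
move=> ux us; apply/eqP; rewrite -subr_eq0; apply/eqP.
apply: (@unorm_le_eq0 _ _ _ 2) => d /ux [n hn].
have -> : x^† - x = (u n - x) - (u n - x)^† by rewrite ustarB (us n); nc.
by rewrite (le_trans (unormB _ _)) // unorm_star; lra.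
Qed.

(* [1 - w] is the square root of [1 - v], the fixed point [w = (v + w^2)/2]
   being obtained by iteration from [0]. *)
Lemma usqrt_fixpoint v : usa v -> N v <= 1 -> exists w,
  [/\ usa w, N w <= 1, w = 2^-1 *: (v + w * w)
    & forall c, c * v = v * c -> c * w = w * c].
Proof.
move=> vs v1; pose u n : U := iter n (fun w => 2^-1 *: (v + w * w)) 0.
pose r n : R := iter n (fun t => 2^-1 * (1 + t * t)) 0.
have uS n : u n.+1 = 2^-1 *: (v + u n * u n) by [].
have rS n : r n.+1 = 2^-1 * (1 + r n * r n) by [].
have us n : usa (u n).
  elim: n => [|n IH]; first exact: ustar0.
  by rewrite uS; apply: usaZ; apply: usaD => //; exact: usa_sqr.
have uc c n : c * v = v * c -> c * u n = u n * c.
  move=> cv; elim: n => [|n IH]; first by rewrite mulr0 mul0r.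
  rewrite uS -scalerAr -scalerAl mulrDl mulrDr cv.
  by rewrite mulrA IH -mulrA IH mulrA.
have uu m n : u m * u n = u n * u m.
  by apply: (uc (u m)); rewrite -(uc v m).
have r01 n : 0 <= r n <= 1.
  elim: n => [|n /andP[h0 h1]]; first by rewrite /= lexx ler01.
  by rewrite rS; apply/andP; split; nra.
have ur n : N (u n) <= r n.
  elim: n => [|n IH]; first by rewrite unorm0.
  rewrite uS rS unormZ ger0_norm ?invr_ge0 ?ler0n // ler_wpM2l ?invr_ge0 ?ler0n //.
  apply: (le_trans (unormD _ _)); apply: lerD => //.
  apply: (le_trans (unormM _ _)); apply: ler_pM => //; exact: unorm_ge0.
have [w uw] : exists w, forall d, 0 < d -> exists n, forall m,
    (n <= m)%N -> N (u m - w) <= d.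
  apply: (@unorm_bounded_variation _ _ u r 1) => n; last first.
    by case/andP: (r01 n).
  elim: n => [|n IH].
    rewrite uS rS /= mulr0 addr0 mulr0 addr0 !subr0 unormZ ger0_norm ?invr_ge0 //.
    by rewrite ler_wpM2l ?invr_ge0.
  have -> : u n.+2 - u n.+1 = 2^-1 *: ((u n.+1 - u n) * (u n.+1 + u n)).
    rewrite mulrBl !mulrDr (uu n n.+1) [u n.+2]uS [in X in _ - X = _]uS.
    by generalize (u n.+1) (u n) => p q; nc.
  have -> : r n.+2 - r n.+1 = 2^-1 * ((r n.+1 - r n) * (r n.+1 + r n)).
    by rewrite [r n.+2]rS [in X in _ - X = _]rS; ring.
  rewrite unormZ ger0_norm ?invr_ge0 ?ler0n // ler_wpM2l ?invr_ge0 ?ler0n //.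
  apply: (le_trans (unormM _ _)); apply: ler_pM => //; try exact: unorm_ge0.
  by apply: (le_trans (unormD _ _)); apply: lerD.
have uw' (d : R) : 0 < d -> exists n, N (u n - w) <= d.
  by move=> /uw [n hn]; exists n; apply: hn.
exists w; split.
- exact: (@unorm_lim_sa u).
- apply/ler_addgt0Pr => d /uw' [n hn].
  rewrite -(subrK (u n) w) (le_trans (unormD _ _)) // unormBC addrC.
  by apply: lerD => //; apply: le_trans (ur n) _; case/andP: (r01 n).
- apply/eqP; rewrite -subr_eq0; apply/eqP.
  apply: (@unorm_le_eq0 _ _ _ (1 + 2^-1 * (N w + 1))) => e e0.
  have [n hn] := uw _ e0; have a1 := hn _ (leqnn n); have a2 := hn _ (leqnSn n).
  have -> : w - 2^-1 *: (v + w * w) = 2^-1 *: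
      (w * (u n - w) + (u n - w) * u n) - (u n.+1 - w) by rewrite uS; nc.
  apply: (le_trans (unormB _ _)).
  have -> : (1 + 2^-1 * (N w + 1)) * e = 2^-1 * (N w * e + e * 1) + e by ring.
  rewrite lerD // unormZ ger0_norm ?invr_ge0 ?ler0n //.
  rewrite ler_wpM2l ?invr_ge0 ?ler0n //.
  apply: (le_trans (unormD _ _)); rewrite lerD //.
    by rewrite (le_trans (unormM _ _)) // ler_wpM2l ?unorm_ge0.
  rewrite (le_trans (unormM _ _)) // ler_pM ?unorm_ge0 //.
  by rewrite (le_trans (ur n)) //; case/andP: (r01 n).
- by move=> c cv; apply: (@unorm_lim_comm u) => // n; apply: uc.
Qed.

(** Scaling writes z = t (1 - v) with N v <= 1. The commutation clause replaces functional calculus: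
    the uniqueness of roots and the positivity of commuting conjugates both depend on it. *)
Lemma upos_sqrt z : upos z -> exists s,
  [/\ upos s, s * s = z & forall c, c * z = z * c -> c * s = s * c].
Proof.
move=> zp; have [->|z0] := eqVneq z 0.
  by exists 0; split=> //; [exact: upos0 | rewrite mulr0].
have t0 := unorm_gt0 z0; set t := N z in t0.
pose v := 1 - t^-1 *: z.
have tv : t *: v = t%:A - z by rewrite scalerBr scalerA mulfV ?gt_eqF // scale1r.
have [||w [ws w1 wE wc]] := @usqrt_fixpoint v.
- by apply: usaB; [exact: usa1 | apply: usaZ; exact: zp.1].
- rewrite -(ler_pM2l t0) mulr1 -[X in X * _](ger0_norm (ltW t0)) -unormZ tv.
  exact: upos_unorm_sub.
have tt : Num.sqrt t * Num.sqrt t = t by rewrite -expr2 sqr_sqrtr ?ltW.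
exists (Num.sqrt t *: (1 - w)); split.
- apply: (@upos_unorm _ _ _ (Num.sqrt t)).
    by apply: usaZ; apply: usaB ws; exact: usa1.
  have -> : (Num.sqrt t)%:A - Num.sqrt t *: (1 - w) = Num.sqrt t *: w by nc.
  by rewrite unormZ ger0_norm ?sqrtr_ge0 // ler_piMr ?sqrtr_ge0.
- have ww : w * w = 2 *: w - v.
    by rewrite [in RHS]wE scalerA mulfV ?pnatr_eq0 // scale1r addrC addKr.
  rewrite -scalerAl -scalerAr scalerA tt.
  have -> : (1 - w) * (1 - w) = 1 - 2 *: w + w * w by nc.
  rewrite ww; have -> : 1 - 2 *: w + (2 *: w - v) = 1 - v by nc.
  by rewrite scalerBr tv; nc.
- move=> c cz; rewrite -scalerAl -scalerAr mulrBl mulrBr mul1r mulr1 wc //.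
  by rewrite mulrBl mulrBr mul1r mulr1 -scalerAl -scalerAr cz.
Qed.

(** With q the root of b, the conjugate is the square of the selfadjoint e q. The general
    [upos_conj] comes only after [upos_starM], whose proof relies on this commuting case. *)
Lemma upos_conj_comm b e : upos b -> usa e -> e * b = b * e -> upos (e * b * e).
Proof.
move=> /upos_sqrt [q [qp <- qc]] es /qc eq.
have -> : e * (q * q) * e = (e * q) * (e * q) by rewrite mulrA eq -!mulrA.
by apply: upos_sqr; apply: usaM => //; exact: qp.1.
Qed.

Lemma unorm_cube_eq0 e : usa e -> e * e * e = 0 -> e = 0.
Proof.
move=> es h; apply: unorm_eq0; apply/eqP.
have : N (e * e * (e * e)) = 0 by rewrite mulrA h mul0r unorm0.
rewrite unorm_sqr; last exact: usa_sqr.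
by rewrite unorm_sqr // => /eqP; rewrite !expf_eq0.
Qed.

(** For e = s - b, the positive elements e s e and e b e have sum (s^2 - b^2) e = 0, so both vanish,
    and their difference is e^3. *)
Lemma upos_sqrt_unique s b : upos s -> upos b -> s * b = b * s ->
  s * s = b * b -> s = b.
Proof.
move=> sp bp c h; pose e := s - b.
have es : usa e by apply: usaB; [exact: sp.1 | exact: bp.1].
have h0 : e * s * e = - (e * b * e).
  apply/eqP; rewrite -addr_eq0; apply/eqP.
  transitivity ((s * s - b * b - b * s + s * b) * e); first by rewrite /e; nc.
  by rewrite c h subrr sub0r addNr mul0r.
have p1 : upos (e * s * e).
  by apply: upos_conj_comm => //; rewrite /e mulrBl mulrBr c.
have p2 : upos (e * b * e).
  by apply: upos_conj_comm => //; rewrite /e mulrBl mulrBr c.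
have h1 : e * b * e = 0.
  by apply: upos_anti; rewrite // -h0.
apply/eqP; rewrite -subr_eq0; apply/eqP; apply: unorm_cube_eq0 => //.
rewrite -/e; transitivity (e * s * e - e * b * e); last by rewrite h0 h1 subr0 oppr0.
by rewrite -mulrBl -mulrBr.
Qed.

Lemma upos_comm_sqr b c : upos b -> c * (b * b) = b * b * c -> c * b = b * c.
Proof.
move=> bp; have [s [sp sE sc]] := upos_sqrt (upos_sqr bp.1).
move=> /sc; suff -> : s = b by [].
by apply: upos_sqrt_unique => //; rewrite sc // mulrA.
Qed.

(** The factor e + d of e^3 + d^3 inherits invertibility from the product. *)
Lemma upos_cube e : usa e -> upos (e * e * e) -> upos e.
Proof.
move=> es [_ h]; split=> // d d0.
have /h : 0 < d ^+ 3 by rewrite exprn_gt0.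
have -> : e * e * e + (d ^+ 3)%:A =
  (e + d%:A) * (e * e - d *: e + (d ^+ 2)%:A) by nc.
apply: uinv_comm_factor; nc.
Qed.

Section AbsoluteValue.
Variables (h b : U).
Hypotheses (hs : usa h) (bp : upos b) (bh : b * b = h * h).

Let f := 2^-1 *: (b + h).
Let e := 2^-1 *: (b - h).

Lemma uabs_comm : h * b = b * h.
Proof. by apply: upos_comm_sqr => //; rewrite bh mulrA. Qed.

Lemma upospart_mulr : f * e = 0.
Proof.
transitivity ((2^-1 * 2^-1) *: (b * b - h * h + h * b - b * h)).
  by rewrite /f /e; nc.
by rewrite uabs_comm bh subrr add0r subrr scaler0.
Qed.

Lemma upospart_mull : e * f = 0.
Proof.
transitivity ((2^-1 * 2^-1) *: (b * b - h * h - h * b + b * h)).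
  by rewrite /f /e; nc.
by rewrite uabs_comm bh subrr sub0r addNr scaler0.
Qed.

(** Because b = f + e and f e = 0, the cube f^3 equals f b f, which is positive since f commutes
    with b. *)
Lemma upospart_upos : upos f.
Proof.
have fs : usa f by apply: usaZ; apply: usaD => //; exact: bp.1.
apply: upos_cube => //.
have -> : f * f * f = f * b * f.
  have -> : b = f + e by rewrite /f /e; nc.
  by rewrite mulrDr upospart_mulr addr0.
apply: upos_conj_comm => //.
by rewrite -scalerAl -scalerAr mulrDl mulrDr uabs_comm.
Qed.

End AbsoluteValue.

Lemma upos_decomposition h : usa h -> exists f e,
  [/\ upos f, upos e, f * e = 0, e * f = 0 & h = f - e].
Proof.
move=> hs; have [b [bp bh _]] := upos_sqrt (upos_sqr hs).
exists (2^-1 *: (b + h)), (2^-1 *: (b - h)); split.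
- exact: upospart_upos.
- by apply: (@upospart_upos (- h)) => //; [exact: usaN | rewrite mulrNN].
- exact: upospart_mulr.
- exact: upospart_mull.
- nc.
Qed.

(** The inverse d^-1 (1 - y g x), where g inverts x y + d, is read off the formal geometric series
    of (y x + d)^-1. *)
Lemma uinv_swap x y d : 0 < d -> uinv (x * y + d%:A) -> uinv (y * x + d%:A).
Proof.
move=> d0 [g [gr gl]].
have d0' : d != 0 by rewrite gt_eqF.
have xyg : x * y * g = 1 - d *: g.
  by rewrite -gr mulrDl -scalerAl mul1r addrK.
have gxy : g * (x * y) = 1 - d *: g.
  by rewrite -gl mulrDr -scalerAr mulr1 addrK.
exists (d^-1 *: (1 - y * g * x)); split.
- transitivity (d^-1 *: (y * x - y * (x * y * g) * x) +
    (d^-1 * d) *: (1 - y * g * x)).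
    by nc.
  by rewrite xyg mulVf // scale1r; nc.
- transitivity (d^-1 *: (y * x - y * (g * (x * y)) * x) +
    (d^-1 * d) *: (1 - y * g * x)).
    by nc.
  by rewrite gxy mulVf // scale1r; nc.
Qed.

(* Kaplansky's argument: if [e] is the negative part of [y^* y] and [u = y e],
   then [u^* u = - e^3], while [u^* u + u u^*] is a sum of squares; as [u^* u]
   and [u u^*] have the same spectrum up to [0], both signs are possible for
   [u^* u] only if [e = 0]. *)
Lemma upos_starM y : upos (y^† * y).
Proof.
have [f [e [fp ep fe ef hE]]] := upos_decomposition (usa_starM y).
suff e0 : e = 0 by rewrite hE e0 subr0.
have es : usa e := ep.1.
pose u := y * e.
have uu : u^† * u = - (e * e * e).
  transitivity (e * (y^† * y) * e); first by rewrite /u ustarM es !mulrA.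
  by rewrite hE mulrBr ef sub0r mulNr.
have e3 : upos (e * e * e).
  by apply: upos_conj_comm.
suff : upos (- (e * e * e)) by move=> /(upos_anti e3); exact: unorm_cube_eq0.
have us : usa (u * u^†) by rewrite -{1}(ustarK u); exact: usa_starM.
(* Real and imaginary parts of [u], for which u^† u + u u^† = 2 p^2 + 2 q^2. *)
pose p := 2^-1 *: (u + u^†); pose q := 2^-1 *: (uI * (u^† - u)).
have ps : usa p by apply: usaZ; rewrite /usa ustarD ustarK addrC.
have qs : usa q.
  apply: usaZ; rewrite /usa ustarM ustarB ustarK ustarI mulrN -mulNr opprB.
  by rewrite uI_comm.
have uup : upos (u * u^†).
  have -> : u * u^† = 2 *: (p * p) + 2 *: (q * q) + e * e * e.
    have -> : q * q = - (2^-1 * 2^-1) *: ((u^† - u) * (u^† - u)).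
      rewrite /q -scalerAl -scalerAr scalerA mulrA -(mulrA uI) -[_ * uI]uI_comm.
      by rewrite mulrA uI_sqr mulN1r mulNr scalerN scaleNr.
    rewrite -[e * e * e]opprK -uu /p.
    by nc.
  by apply: uposD => //; apply: uposD; apply: uposZ => //; exact: upos_sqr.
rewrite -uu; split=> [|d d0]; first exact: usa_starM.
by apply: uinv_swap => //; apply: uup.2.
Qed.

Lemma upos_conj c x : upos x -> upos (c^† * x * c).
Proof.
move=> /upos_sqrt [s [[ss _] <- _]].
have -> : c^† * (s * s) * c = (s * c)^† * (s * c).
  by rewrite ustarM ss !mulrA.
exact: upos_starM.
Qed.

End SquareRoots.

(** * Order and distance inequalities *)

Section Inequalities.
Context {R : realType} {U : ucstarType R}.
Implicit Types (x y z a b c f h k p r : U) (t d e m : R).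

Local Notation N := (@unorm R U).
Local Notation "x ^†" := (ustar x) (at level 2, format "x ^†").
Local Notation uI := (@uI R U).

Local Ltac nc := nc_ring_simplify R U; repeat split; first [ring | by field].

(** Since f g = 0, one has f h f = f^3, so h <= t gives f^3 <= t f^2, and N f^4 = N (f^4) <= t N
    f^3. Conversely t - h = (t - f) + g. *)
Lemma unorm_upospart_le h b t : usa h -> upos b -> b * b = h * h -> 0 <= t ->
  N (2^-1 *: (b + h)) <= t <-> upos (t%:A - h).
Proof.
move=> hs bp bh t0; pose f := 2^-1 *: (b + h); pose g := 2^-1 *: (b - h).
have fp : upos f by exact: upospart_upos.
have gp : upos g.
  by apply: (@upospart_upos _ _ (- h)) => //; [exact: usaN | rewrite mulrNN].
have fg : f * g = 0 by exact: upospart_mulr.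
have hE : h = f - g by rewrite /f /g; nc.
rewrite -/f; split=> [ft|th].
  have -> : t%:A - h = (t%:A - f) + g by rewrite hE; nc.
  by apply: uposD => //; apply: upos_scalar_sub => //; exact: fp.1.
have [n0|n0] := eqVneq (N f) 0; first by rewrite n0.
have nf : 0 < N f by rewrite lt0r n0 unorm_ge0.
have h1 : N (f * f * f) <= t * N f ^+ 2.
  apply: unorm_upos_le.
  - by rewrite mulr_ge0 ?sqr_ge0.
  - by apply: upos_conj_comm => //; exact: fp.1.
  have -> : (t * N f ^+ 2)%:A - f * f * f =
      t *: ((N f ^+ 2)%:A - f * f) + f * (t%:A - h) * f.
    have -> : f * (t%:A - h) * f = t *: (f * f) - f * f * f + f * g * f.
      by rewrite hE; nc.
    by rewrite fg mul0r addr0; nc.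
  apply: uposD.
    apply: uposZ => //; apply: upos_scalar_sub; first exact: usa_sqr fp.1.
    by rewrite unorm_sqr //; exact: fp.1.
  by have := upos_conj f th; rewrite fp.1.
have : N f ^+ 4 <= t * N f ^+ 3.
  have -> : N f ^+ 4 = N (f * f * f * f).
    rewrite -mulrA (unorm_sqr (usa_sqr fp.1)) (unorm_sqr fp.1); ring.
  apply: (le_trans (unormM _ _)).
  have -> : t * N f ^+ 3 = t * N f ^+ 2 * N f by ring.
  by rewrite ler_wpM2r ?unorm_ge0.
by rewrite (exprS _ 3) ler_pM2r // exprn_gt0.
Qed.

Definition uunit_interval a := upos a /\ upos (1 - a).

Lemma uunit_intervalC a : uunit_interval a -> uunit_interval (1 - a).
Proof. by case=> h1 h2; split=> //; rewrite opprB addrC subrK. Qed.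

Lemma unorm_unit_interval a : uunit_interval a -> N a <= 1.
Proof. by case=> h1 h2; apply: unorm_upos_le => //; rewrite scale1r. Qed.

Lemma upos_1Bsqr a : usa a -> N a <= 1 -> upos (1 - a * a).
Proof.
move=> sa a1; rewrite -[1]scale1r; apply: upos_scalar_sub; first exact: usa_sqr.
by rewrite unorm_sqr // expr_le1 // unorm_ge0.
Qed.

(** p is within 2 e of a p a, and a p a <= a^2 because p <= 1. *)
Lemma upos_approx_unit p a e : uunit_interval p -> uunit_interval a ->
  N (p - p * a) <= e -> upos (a * a + (2 * e)%:A - p).
Proof.
move=> [pp p1] ai h; have [as_ _] := ai.1; have ps := pp.1.
have -> : a * a + (2 * e)%:A - p =
    a * (1 - p) * a + ((2 * e)%:A - (p - a * p * a)) by nc.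
apply: uposD; first by have := upos_conj a p1; rewrite as_.
apply: upos_scalar_sub.
  by apply: usaB => //; have := usa_conj a ps; rewrite as_.
have -> : p - a * p * a = (p - p * a)^† + a * (p - p * a).
  by rewrite ustarB ustarM ps as_; nc.
apply: (le_trans (unormD _ _)); rewrite unorm_star.
have := le_trans (unormM a (p - p * a))
  (ler_wpM2r (unorm_ge0 _) (unorm_unit_interval ai)).
by lra.
Qed.

(* [a^2 + c^2 = T T^*] for the row [T = (a c)], while [T^* T] differs by
   off-diagonal entries of norm [N (a * c)] from a contraction. *)
Lemma upos_Dsqr_bound a c m : uunit_interval a -> uunit_interval c -> 0 < m ->
  N (a * c) <= m -> upos ((1 + m)%:A - (a * a + c * c)).
Proof.
move=> ai ci m0 acm; have as_ := ai.1.1; have cs := ci.1.1.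
pose S := a * a + c * c.
have Sp : upos S by apply: uposD; exact: upos_sqr.
(* Completing the square: v^† v produces the mixed terms a^2 c^2 + c^2 a^2 with coefficient -m and
   leaves the remainder c^2 a^2 c^2, which is at most m^2 c^2. *)
pose v := m *: a - a * c * c.
have vE : v^† = m *: a - c * c * a.
  by rewrite ustarB ustarZ !ustarM as_ cs mulrA.
have h1 : upos (m *: S - a * a * (c * c) - c * c * (a * a)).
  have -> : m *: S - a * a * (c * c) - c * c * (a * a) = m^-1 *:
      (v^† * v + c * ((m ^+ 2)%:A - (a * c)^† * (a * c)) * c).
    rewrite vE /v /S ustarM as_ cs.
    by nc_ring_simplify R U; repeat split;
       first [ring | by field; rewrite gt_eqF].
  apply: uposZ; first by rewrite invr_ge0 ltW.
  apply: uposD; first exact: upos_starM.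
  rewrite -{1}cs; apply: upos_conj; apply: upos_scalar_sub.
    exact: usa_starM.
  by rewrite unormS lerXn2r ?nnegrE ?unorm_ge0 // ltW.
have sq x : uunit_interval x -> upos (x * x - x * x * (x * x)).
  move=> xi; have xs := xi.1.1.
  have -> : x * x - x * x * (x * x) = x^† * (1 - x * x) * x by rewrite xs; nc.
  by apply: upos_conj; apply: upos_1Bsqr => //; exact: unorm_unit_interval.
have h2 : upos ((1 + m) *: S - S * S).
  have -> : (1 + m) *: S - S * S = (a * a - a * a * (a * a)) +
      (c * c - c * c * (c * c)) +
      (m *: S - a * a * (c * c) - c * c * (a * a)) by rewrite /S; nc.
  by apply: uposD => //; apply: uposD; exact: sq.
apply: upos_scalar_sub; first exact: Sp.1.
rewrite -/S; have n0 := unorm_ge0 S.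
have : N (S * S) <= (1 + m) * N S.
  apply: unorm_upos_le.
  - by rewrite mulr_ge0 // addr_ge0 // ltW.
  - exact: upos_sqr Sp.1.
  have -> : ((1 + m) * N S)%:A - S * S =
    (1 + m) *: ((N S)%:A - S) + ((1 + m) *: S - S * S) by nc.
  apply: uposD => //; apply: uposZ; first by rewrite addr_ge0 // ltW.
  by apply: upos_scalar_sub => //; exact: Sp.1.
rewrite unorm_sqr; last exact: Sp.1.
have [->|nS] := eqVneq (N S) 0; first by move=> _; rewrite addr_ge0 // ltW.
by rewrite expr2 ler_pM2r // lt0r nS.
Qed.

Lemma upos_sub_le_dist a a' b b' e m :
  uunit_interval a -> uunit_interval a' -> uunit_interval b ->
  uunit_interval b' -> N (a' - a' * a) <= e -> N (b' - b' * b) <= e ->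
  0 < m -> N (a - a * b') <= m -> upos ((m + 4 * e)%:A - (a' - b)).
Proof.
move=> ai a'i bi b'i ha hb m0 hm.
have h1 := upos_approx_unit a'i ai ha.
(* Since b' is nearly b' b, the product (1 - b) b' is small: 1 - b' is an approximate right unit for
   1 - b. *)
have h2 : upos ((1 - b') * (1 - b') + (2 * e)%:A - (1 - b)).
  apply: upos_approx_unit; try exact: uunit_intervalC.
  have -> : 1 - b - (1 - b) * (1 - b') = (b' - b' * b)^†; last by rewrite unorm_star.
  by rewrite ustarB ustarM bi.1.1 b'i.1.1; nc.
have h3 : upos ((1 + m)%:A - (a * a + (1 - b') * (1 - b'))).
  apply: upos_Dsqr_bound => //; first exact: uunit_intervalC.
  by rewrite mulrBr mulr1.
have -> : (m + 4 * e)%:A - (a' - b) = (a * a + (2 * e)%:A - a') +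
  ((1 - b') * (1 - b') + (2 * e)%:A - (1 - b)) +
  ((1 + m)%:A - (a * a + (1 - b') * (1 - b'))) by nc.
by apply: uposD => //; exact: uposD.
Qed.

(** Evaluation of a quadratic bound at the top of the spectrum of k: if it failed there, the factor
    N k - k of the invertible difference would be invertible, and so is N k + k. *)
Lemma unorm_quadratic_le k t m : upos k -> 0 <= t -> 0 <= m ->
  upos (m%:A - (k * k + t *: k)) -> N k ^+ 2 + t * N k <= m.
Proof.
move=> kp t0 m0 [_ h]; have [->|n0] := eqVneq (N k) 0.
  by rewrite expr0n mulr0 addr0.
have nk : 0 < N k by rewrite lt0r n0 unorm_ge0.
rewrite leNgt; apply/negP => lt; apply: (unorm_not_uinv kp.1); last first.
  by rewrite addrC; exact: kp.2.
apply: (@uinv_comm_factor _ _ _ ((N k)%:A + k + t%:A)); first by nc.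
have -> : ((N k)%:A - k) * ((N k)%:A + k + t%:A) =
  m%:A - (k * k + t *: k) + (N k ^+ 2 + t * N k - m)%:A by nc.
by apply: h; rewrite subr_gt0.
Qed.

End Inequalities.

(** * Bounding d by h *)

Section DistanceBound.
Context {R : realType} {U : ucstarType R}.
Implicit Types (x y z a b c f h k p r : U) (t d e m : R).

Local Notation N := (@unorm R U).
Local Notation "x ^†" := (ustar x) (at level 2, format "x ^†").
Local Notation uI := (@uI R U).

Local Ltac nc := nc_ring_simplify R U; repeat split; first [ring | by field].

Lemma unormM_le x y t d : N x <= t -> N y <= d -> N (x * y) <= t * d.
Proof.
by move=> h1 h2; apply: (le_trans (unormM _ _)); apply: ler_pM; rewrite ?unorm_ge0.
Qed.

Lemma unormD_le x y t d : N x <= t -> N y <= d -> N (x + y) <= t + d.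
Proof. by move=> h1 h2; apply: (le_trans (unormD _ _)); apply: lerD. Qed.

Lemma unormZ_le t x d : 0 <= t <= 1 -> N x <= d -> N (t *: x) <= d.
Proof.
move=> /andP[t0 t1] h; rewrite unormZ ger0_norm //; apply: le_trans h.
by rewrite ler_piMl ?unorm_ge0.
Qed.

Lemma upos_Bsqr a : uunit_interval a -> upos (a - a * a).
Proof.
move=> [ap a1]; have -> : a - a * a = a * (1 - a) * a + (1 - a) * a * (1 - a) by nc.
apply: uposD; first by have := upos_conj a a1; rewrite ap.1.
by have := upos_conj (1 - a) ap; rewrite a1.1.
Qed.

(** Here the square sits on the smaller side, via a >= a^2 and p >= p^2: the compression by [w]
    below needs p^2 under a and c^2 under 1 - f. *)
Lemma upos_approx_unit_sqr p a e : uunit_interval p -> uunit_interval a ->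
  N (p - p * a) <= e -> upos (a + (2 * e)%:A - p * p).
Proof.
move=> pi ai h.
have -> : a + (2 * e)%:A - p * p =
  (a - a * a) + (a * a + (2 * e)%:A - p) + (p - p * p) by nc.
by apply: uposD; [apply: uposD; [exact: upos_Bsqr | exact: upos_approx_unit] |
  exact: upos_Bsqr].
Qed.

(* When [p] and [c = 1 - b] are projections, the element [w] below maps a top
   singular vector of [p * c] to an eigenvector of [p + c - 1] for the eigenvalue
   [N (p * c)]. *)
Lemma dist_le_of_upos_sub p a b f t e : uunit_interval p -> uunit_interval a ->
  uunit_interval b -> uunit_interval f -> 0 <= t -> 0 <= e ->
  upos (t%:A - (a - f)) -> N (p - p * a) <= e -> N (f - f * b) <= e ->
  N (p - p * b) ^+ 2 * (N (p - p * b) - t) <= 5 * e.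
Proof.
move=> pi ai bi fi t0 e0 haf hp hf.
pose c := 1 - b; have ci : uunit_interval c by exact: uunit_intervalC.
have ri := uunit_intervalC fi.
have -> : p - p * b = p * c by rewrite mulrBr mulr1.
set m := N (p * c).
have ps : p^† = p := pi.1.1; have cs : c^† = c := ci.1.1.
have as_ : usa a := ai.1.1; have fs : usa f := fi.1.1.
have np := unorm_unit_interval pi; have ncc := unorm_unit_interval ci.
have m0 : 0 <= m by exact: unorm_ge0.
have m1 : m <= 1 by rewrite -[1]mulr1; apply: unormM_le.
have m01 : 0 <= m <= 1 by rewrite m0.
have nz' : N (c * p) = m by rewrite -unorm_star ustarM ps cs.
pose w := p * (p * c) + m *: c.
have wE : w^† = c * p * p + m *: c by rewrite ustarD ustarZ !ustarM ps cs.
pose k := (p * c)^† * (p * c).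
have kE : k = c * p * (p * c) by rewrite /k ustarM ps cs.
have kp : upos k by exact: upos_starM.
have nk : N k = m ^+ 2 by exact: unormS.
pose e1 := a * p - p; pose e2 := f * c.
have ne1 : N e1 <= e by rewrite -unorm_star ustarB ustarM ps as_ -unormN opprB.
have ne1' : N (p * a - p) <= e by rewrite -unormN opprB.
have ne2 : N e2 <= e by rewrite /e2 mulrBr mulr1.
have ne2' : N (c * f) <= e by rewrite -unorm_star ustarM cs fs.
(* The loss on replacing a p by p and f c by 0 in w^† (a - f) w. What remains is c p^2 (1 - f) p^2 c
   + 2 m k + m^2 c a c, here split so that c^2 <= 1 - f yields k^2 and p^2 <= a yields m^2 k. *)
pose err := w^† * (a - f) * w -
  (c * p * p * (1 - f - c * c) * (p * p * c) + k * k + (2 * m) *: k +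
   m ^+ 2 *: k + m ^+ 2 *: (c * (a - p * p) * c)).
have errE : err =
  (c * p * p * e1 * (p * c)) - m *: (c * p * p * e2 ) + m *: (c * p * (p * a - p) * c)
  - m *: (c * f * (p * p * c)) + m *: (c * e1 * (p * c))
  - (m * m) *: (c * e2).
  rewrite /err wE kE /w /e1 /e2.
  by nc.
have ppc : N (p * p * c) <= m.
  by rewrite -mulrA -[m]mul1r; apply: unormM_le.
have cpp : N (c * p * p) <= m by rewrite -[m]mulr1; apply: unormM_le; rewrite ?nz'.
have t1 : N (c * p * p * e1 * (p * c)) <= e.
  apply: le_trans (unormM_le (unormM_le cpp ne1) (lexx _)) _; rewrite -/m.
  by have := mulr_ge0 e0 m0; nra.
have t2 : N (c * p * p * e2) <= e.
  by apply: le_trans (unormM_le cpp ne2) _; nra.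
have t3 : N (c * p * (p * a - p) * c) <= e.
  have h : N (c * p) <= m by rewrite nz'.
  by apply: le_trans (unormM_le (unormM_le h ne1') ncc) _; nra.
have t4 : N (c * f * (p * p * c)) <= e.
  by apply: le_trans (unormM_le ne2' ppc) _; nra.
have t5 : N (c * e1 * (p * c)) <= e.
  by apply: le_trans (unormM_le (unormM_le ncc ne1) (lexx _)) _; rewrite -/m; nra.
have t6 : N (c * e2) <= e.
  by apply: le_trans (unormM_le ncc ne2) _; rewrite mul1r.
have nerr : N err <= 6 * e.
  have mm : 0 <= m * m <= 1 by apply/andP; split; nra.
  rewrite errE; have -> : 6 * e = e + e + e + e + e + e by ring.
  by do ?[apply: unormD_le]; rewrite ?unormN //; exact: unormZ_le.
have rs : usa (1 - f - c * c).
  by apply: usaB; [apply: usaB => //; exact: usa1 | exact: usa_sqr].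
have conjc x : usa x -> usa (c * x * c) by move=> /(usa_conj c); rewrite cs.
have cppE : c * p * p = (p * p * c)^† by rewrite !ustarM ps cs mulrA.
have errs : usa err.
  apply: usaB; first by apply: usa_conj; exact: usaB.
  apply: usaD; last first.
    by apply/usaZ/conjc/usaB => //; exact: usa_sqr.
  apply: usaD; last exact: usaZ kp.1.
  apply: usaD; last exact: usaZ kp.1.
  apply: usaD; last exact: usa_sqr kp.1.
  by rewrite cppE; apply: usa_conj.
have hr : upos (1 - f + (2 * e)%:A - c * c).
  by apply: upos_approx_unit_sqr => //; rewrite mulrBr mulr1 opprB addrC subrK.
have ha : upos (a + (2 * e)%:A - p * p) by exact: upos_approx_unit_sqr.
(* The factor of t bounds w^† w, whose parts (p^2 c)^† (p^2 c), 2 m k and m^2 c^2 are at most m^2, 2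
   m^3 and m^2. The 10 e consists of 6 e from [err] and 2 e from each of [hr] and [ha]. *)
pose M := t * (2 * m ^+ 2 + 2 * m ^+ 3) + 10 * e.
have main : upos (M%:A - (k * k + (2 * m + m ^+ 2) *: k)).
  have -> : M%:A - (k * k + (2 * m + m ^+ 2) *: k) =
      t *: ((m ^+ 2)%:A - (p * p * c)^† * (p * p * c)) +
      (2 * m * t) *: ((m ^+ 2)%:A - k) + (t * m ^+ 2) *: (1 - c * c) +
      w^† * (t%:A - (a - f)) * w +
      (p * p * c)^† * (1 - f + (2 * e)%:A - c * c) * (p * p * c) +
      m ^+ 2 *: (c^† * (a + (2 * e)%:A - p * p) * c) +
      (2 * e) *: (1 - (p * p * c)^† * (p * p * c)) +
      (2 * e) *: (1%:A - m ^+ 2 *: (c * c)) +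
      ((6 * e)%:A + err).
    rewrite /err -cppE wE cs kE /w /M.
    by nc.
  have m2 : 0 <= m ^+ 2 by rewrite sqr_ge0.
  have pp2 : N ((p * p * c)^† * (p * p * c)) <= m ^+ 2.
    by rewrite unormS lerXn2r ?nnegrE ?unorm_ge0.
  have c2 : usa (c * c) by exact: usa_sqr.
  have ncc2 : N (c * c) <= 1 by rewrite -[1]mulr1; exact: unormM_le.
  apply: uposD; last first.
    rewrite -[err]opprK; apply: upos_scalar_sub; first exact: usaN.
    by rewrite unormN.
  apply: uposD; last first.
    apply: uposZ; first by lra.
    apply: upos_scalar_sub; first exact: usaZ.
    by apply: unormZ_le => //; apply/andP; split=> //; rewrite expr_le1.
  apply: uposD; last first.
    apply: uposZ; first by lra.
    rewrite -[X in X - _]scale1r; apply: upos_scalar_sub; first exact: usa_starM.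
    by apply: le_trans pp2 _; rewrite expr_le1.
  apply: uposD; last by apply: uposZ => //; exact: upos_conj.
  apply: uposD; last exact: upos_conj.
  apply: uposD; last exact: upos_conj.
  apply: uposD; last first.
    by apply: uposZ; [exact: mulr_ge0 | exact: upos_1Bsqr].
  apply: uposD.
    by apply: uposZ => //; apply: upos_scalar_sub pp2; exact: usa_starM.
  apply: uposZ; first by rewrite !mulr_ge0.
  by apply: upos_scalar_sub; [exact: kp.1 | rewrite nk].
have M0 : 0 <= M.
  by rewrite addr_ge0 ?mulr_ge0 ?addr_ge0 ?mulr_ge0 ?exprn_ge0.
have mm0 : 0 <= 2 * m + m ^+ 2 by rewrite addr_ge0 ?mulr_ge0 ?sqr_ge0.
(* As N k = m^2, this reads 2 m^3 (1 + m) <= 2 t m^2 (1 + m) + 10 e. *)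
have := unorm_quadratic_le kp mm0 M0 main; rewrite nk /M => h.
have h' : m ^+ 2 * (m - t) * (1 + m) <= 5 * e by lra.
have [mt|mt] := leP m t.
  have : m ^+ 2 * (m - t) <= 0 by rewrite mulr_ge0_le0 ?sqr_ge0 // subr_le0.
  by lra.
apply: le_trans h'; rewrite ler_peMr ?lerDl //.
by rewrite mulr_ge0 ?sqr_ge0 // subr_ge0 ltW.
Qed.

End DistanceBound.

(** * The unitization *)

Section Completeness.
Variables (K : numFieldType) (V : completeNormedModType K).

(** The field is kept general: the result is applied to real sequences and to sequences in A, whose
    norm lies in [R[i]]. *)
Lemma cauchy_seq_complete (u : nat -> V) :
  (forall e : K, 0 < e -> exists n : nat, forall m : nat,
    (n <= m)%N -> `|u m - u n| <= e) ->
  exists l : V, forall e : K, 0 < e -> exists n : nat, forall m : nat,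
    (n <= m)%N -> `|u m - l| <= e.
Proof.
move=> hu; have cu : cauchy (u x @[x --> \oo]).
  apply: cauchy_exP => e e0.
  have e2 : 0 < e / 2 by rewrite divr_gt0.
  have [n hn] := hu _ e2; exists (u n).
  exists n => // m /= nm.
  rewrite -ball_normE /= distrC (le_lt_trans (hn _ nm)) //.
  by rewrite ltr_pdivrMr // ltr_pMr // ltr1n.
have /cvgrPdist_le cl : u x @[x --> \oo] --> lim (u x @[x --> \oo]).
  exact: (cauchy_cvg _ cu).
exists (lim (u x @[x --> \oo])) => e e0.
have [n _ hn] := cl _ e0; exists n => m nm.
by rewrite distrC; exact: hn.
Qed.

End Completeness.

(** * The real-valued modulus of complex numbers *)

Section ComplexModulus.
Local Open Scope complex_scope.
Context {R : realType}.
Implicit Types k l : R[i].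

Definition cmod k : R := complex.Re `|k|.

Lemma norm_Re (V : normedZmodType R[i]) (x : V) :
  (complex.Re `|x|)%:C = `|x| :> R[i].
Proof. by apply: RRe_real; exact: normr_real. Qed.

Lemma cmod_ge0 k : 0 <= cmod k.
Proof. by rewrite -ler0c norm_Re. Qed.

Lemma cmodD k l : cmod (k + l) <= cmod k + cmod l.
Proof. by rewrite -lecR rmorphD /= !norm_Re ler_normD. Qed.

Lemma cmodM k l : cmod (k * l) = cmod k * cmod l.
Proof. by apply: complexI; rewrite rmorphM /= !norm_Re normrM. Qed.

Lemma cmod_real (r : R) : cmod r%:C = `|r|.
Proof.
by apply: complexI; rewrite norm_Re normc_def /= expr0n addr0 sqrtr_sqr.
Qed.

Lemma cmodJ k : cmod k^* = cmod k.
Proof. by rewrite /cmod normcJ. Qed.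

Lemma cmod_eq0 k : cmod k = 0 -> k = 0.
Proof. by move=> h; apply/eqP; rewrite -normr_eq0 -norm_Re -/(cmod k) h. Qed.

Lemma cmodN k : cmod (- k) = cmod k.
Proof. by rewrite /cmod normrN. Qed.

Lemma Re_le_cmod k : `|complex.Re k| <= cmod k.
Proof. by rewrite -lecR norm_Re normc_ge_Re. Qed.

Lemma cmod_i : cmod 'i = 1.
Proof.
by apply: complexI; rewrite norm_Re normc_def /= expr0n add0r expr1n sqrtr1.
Qed.

Lemma cmod_le k : cmod k <= `|complex.Re k| + `|complex.Im k|.
Proof.
have {1}-> : k = (complex.Re k)%:C + 'i * (complex.Im k)%:C by exact: complexE.
apply: (le_trans (cmodD _ _)); by rewrite cmodM !cmod_real cmod_i mul1r.
Qed.

Lemma Im_le_cmod k : `|complex.Im k| <= cmod k.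
Proof.
have h : complex.Im k = complex.Re ((- 'i) * k) by case: k => a b; simpc.
by rewrite h (le_trans (Re_le_cmod _)) // cmodM cmodN cmod_i mul1r.
Qed.

Lemma complex_seq_complete (u : nat -> R[i]) :
  (forall e : R, 0 < e -> exists n : nat, forall m : nat,
    (n <= m)%N -> cmod (u m - u n) <= e) ->
  exists l : R[i], forall e : R, 0 < e -> exists n : nat, forall m : nat,
    (n <= m)%N -> cmod (u m - l) <= e.
Proof.
move=> hu.
have h (f : R[i] -> R) : (forall k l, f (k - l) = f k - f l) ->
    (forall k, `|f k| <= cmod k) -> exists a, forall e, 0 < e ->
    exists n : nat, forall m, (n <= m)%N -> `|f (u m) - a| <= e.
  move=> fB fm; apply: (@cauchy_seq_complete R R^o) => e /hu [n hn].
  by exists n => m /hn; apply: le_trans; rewrite -fB fm.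
have [||a ha] := h (@complex.Re R); first by case=> ? ? [].

  exact: Re_le_cmod.
have [||b hb] := h (@complex.Im R); first by case=> ? ? [].
  exact: Im_le_cmod.
exists (a +i* b) => e e0; have e2 : 0 < e / 2 by rewrite divr_gt0.
have [n hn] := ha _ e2; have [p hp] := hb _ e2.
exists (maxn n p) => m; rewrite geq_max => /andP[/hn h1 /hp h2].
apply: (le_trans (cmod_le _)); rewrite [e]splitr.
by case: (u m) h1 h2 => ? ? /= h1 h2; exact: lerD.
Qed.

End ComplexModulus.

Section NormOfCStarAlgebra.
Local Open Scope complex_scope.
Context {R : realType} {A : cstarAlgType R}.
Implicit Types (x y z : A) (k : R[i]).

Lemma cnormE x : (cnorm x)%:C = `|x| :> R[i].
Proof. exact: norm_Re. Qed.

Lemma cnorm_ge0 x : 0 <= cnorm x.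
Proof. by rewrite -ler0c cnormE. Qed.

Lemma cnorm0 : cnorm (0 : A) = 0.
Proof. by rewrite /cnorm normr0. Qed.

Lemma cnorm_eq0 x : cnorm x = 0 -> x = 0.
Proof. by move=> h; apply/eqP; rewrite -normr_eq0 -cnormE h. Qed.

Lemma cnormD x y : cnorm (x + y) <= cnorm x + cnorm y.
Proof. by rewrite -lecR rmorphD /= !cnormE ler_normD. Qed.

Lemma cnormZ k x : cnorm (k *: x) = cmod k * cnorm x.
Proof. by apply: complexI; rewrite rmorphM /= !cnormE norm_Re normrZ. Qed.

Lemma cnorm_mul x y : cnorm (cmul x y) <= cnorm x * cnorm y.
Proof. by rewrite -lecR rmorphM /= !cnormE cnormM. Qed.

Lemma cnorm_starM x : cnorm (cmul (cstar x) x) = cnorm x ^+ 2.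
Proof. by apply: complexI; rewrite rmorphXn /= !cnormE cstar_identity. Qed.

Lemma cnorm_star x : cnorm (cstar x) = cnorm x.
Proof.
suff h y : cnorm y <= cnorm (cstar y).
  by apply/eqP; rewrite eq_le h -{2}(cstarK x) h.
have [y0|n0] := eqVneq (cnorm y) 0; first by rewrite y0 cnorm_ge0.
have y0 : 0 < cnorm y by rewrite lt0r n0 cnorm_ge0.
by rewrite -(ler_pM2r y0) -expr2 -cnorm_starM cnorm_mul.
Qed.

Lemma cmul0 x : cmul x 0 = 0.
Proof. by rewrite -[X in cmul _ X](scale0r (0 : A)) cmulZr scale0r. Qed.

Lemma cmul0l x : cmul 0 x = 0.
Proof. by rewrite -[X in cmul X _](scale0r (0 : A)) cmulZl scale0r. Qed.


Lemma cstar0 : cstar (0 : A) = 0.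
Proof. by apply: (addrI (cstar 0)); rewrite -cstarD !addr0. Qed.

End NormOfCStarAlgebra.

(** A separate name, so that the type can carry the unitization product and real scaling rather than
    the structures of a product. *)
Definition unitz (R : realType) (A : cstarAlgType R) : Type :=
  (R[i]%C * A)%type.

Section UnitizationAlgebra.
Local Open Scope complex_scope.
Context {R : realType} {A : cstarAlgType R}.
Local Notation U := (unitz A).
Implicit Types (u v w : U) (r s : R) (k : R[i]).

HB.instance Definition _ := GRing.Zmodule.copy U (R[i] * A)%type.

Let one : U := (1, 0).
Let mul : U -> U -> U := @unitization_mul R A.

Lemma unitz_mulA : associative mul.
Proof.
move=> [k x] [l y] [m z]; rewrite /mul /unitization_mul /= mulrA.
congr pair; rewrite !(cmulDl, cmulDr, cmulZl, cmulZr, scalerDr, scalerA) cmulA.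
rewrite (mulrC m k) (mulrC m l) -!addrA; congr (_ + (_ + _)).
rewrite addrCA; congr (_ + _); rewrite [RHS]addrCA; congr (_ + _).
by rewrite addrCA.
Qed.

Lemma unitz_mul1l : left_id one mul.
Proof.
by move=> [k x]; rewrite /mul /unitization_mul /= mul1r scale1r scaler0 cmul0l !addr0.
Qed.

Lemma unitz_mul1r : right_id one mul.
Proof.
move=> [k x]; rewrite /mul /unitization_mul /= mulr1 scale1r scaler0 cmul0.
by rewrite add0r addr0.
Qed.

Lemma unitz_mulDl : left_distributive mul +%R.
Proof.
move=> [k x] [l y] [m z]; rewrite /mul /unitization_mul /= mulrDl; congr pair.
by rewrite scalerDl scalerDr cmulDl [RHS]addrACA; congr (_ + _); exact: addrACA.
Qed.

Lemma unitz_mulDr : right_distributive mul +%R.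
Proof.
move=> [k x] [l y] [m z]; rewrite /mul /unitization_mul /= mulrDr; congr pair.
by rewrite scalerDl scalerDr cmulDr [RHS]addrACA; congr (_ + _); exact: addrACA.
Qed.

Lemma unitz_oner_neq0 : one != 0.
Proof. by apply/eqP => -[] /eqP; rewrite oner_eq0. Qed.

HB.instance Definition _ := GRing.Zmodule_isNzRing.Build U unitz_mulA
  unitz_mul1l unitz_mul1r unitz_mulDl unitz_mulDr unitz_oner_neq0.

Let scale r u : U := (r%:C * u.1, r%:C *: u.2).

Lemma unitz_scalerA r s u : scale r (scale s u) = scale (r * s) u.
Proof. by rewrite /scale /= mulrA scalerA -rmorphM. Qed.

Lemma unitz_scale1r : left_id 1 scale.
Proof. by move=> [k x]; rewrite /scale /= mul1r scale1r. Qed.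

Lemma unitz_scalerDr : right_distributive scale +%R.
Proof. by move=> r [k x] [l y]; rewrite /scale /= mulrDr scalerDr. Qed.

Lemma unitz_scalerDl u : {morph scale^~ u : r s / r + s}.
Proof. by move=> r s; rewrite /scale /= rmorphD /= mulrDl scalerDl. Qed.

HB.instance Definition _ := GRing.Zmodule_isLmodule.Build R U
  unitz_scalerA unitz_scale1r unitz_scalerDr unitz_scalerDl.

Lemma unitz_scalerAl r u v : r *: (u * v) = r *: u * v.
Proof.
case: u v => [k x] [l y]; rewrite /GRing.scale /GRing.mul /= /scale /mul.
rewrite /unitization_mul /= mulrA; congr pair.
by rewrite !scalerDr !scalerA cmulZl (mulrC r%:C l).
Qed.

HB.instance Definition _ := GRing.Lmodule_isLalgebra.Build R U unitz_scalerAl.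

Lemma unitz_scalerAr r u v : r *: (u * v) = u * (r *: v).
Proof.
case: u v => [k x] [l y]; rewrite /GRing.scale /GRing.mul /= /scale /mul.
rewrite /unitization_mul /= mulrCA; congr pair.
by rewrite !scalerDr !scalerA cmulZr (mulrC r%:C k).
Qed.

HB.instance Definition _ := GRing.Lalgebra_isAlgebra.Build R U unitz_scalerAr.

Lemma unitz_mulE u v : u * v = unitization_mul u v.
Proof. by []. Qed.

Lemma unitz_scaleE r u : r *: u = (r%:C * u.1, r%:C *: u.2).
Proof. by []. Qed.

End UnitizationAlgebra.

(** * The C*-norm and the involution of the unitization *)

Section UnitizationNorm.
Local Open Scope complex_scope.
Context {R : realType} {A : cstarAlgType R}.
Local Notation U := (unitz A).
Implicit Types (u v w : U) (r s : R) (k : R[i]) (c x : A).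

Definition unitz_act u c : A := u.1 *: c + cmul u.2 c.

Lemma unitz_actD u v c : unitz_act (u + v) c = unitz_act u c + unitz_act v c.
Proof. by rewrite /unitz_act /= scalerDl cmulDl addrACA. Qed.

Lemma unitz_actM u v c : unitz_act (u * v) c = unitz_act u (unitz_act v c).
Proof.
rewrite /unitz_act /= scalerDr !cmulDl !cmulDr !cmulZl cmulZr scalerA cmulA.
by rewrite -!addrA.
Qed.

Lemma unitz_actZ r u c : unitz_act (r *: u) c = r%:C *: unitz_act u c.
Proof. by rewrite /unitz_act /= cmulZl scalerDr scalerA. Qed.

Lemma unitz_actZr k u c : unitz_act u (k *: c) = k *: unitz_act u c.
Proof. by rewrite /unitz_act cmulZr scalerDr !scalerA mulrC. Qed.

Definition unitz_opnorm u : R :=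
  sup [set cnorm (unitz_act u c) | c in [set c | cnorm c <= 1]].

Lemma unitz_act_bound u c :
  cnorm (unitz_act u c) <= (cmod u.1 + cnorm u.2) * cnorm c.
Proof.
apply: (le_trans (cnormD _ _)).
by rewrite cnormZ mulrDl lerD2l cnorm_mul.
Qed.

Lemma unitz_act_le1 u c : cnorm c <= 1 -> cnorm (unitz_act u c) <= unitz_opnorm u.
Proof.
move=> c1; apply: ub_le_sup; last by exists c.
exists (cmod u.1 + cnorm u.2) => _ [d d1 <-].
apply: (le_trans (unitz_act_bound u d)).
by rewrite ler_piMr // addr_ge0 ?cmod_ge0 ?cnorm_ge0.
Qed.

Lemma unitz_opnorm_le u r :
  (forall c, cnorm c <= 1 -> cnorm (unitz_act u c) <= r) -> unitz_opnorm u <= r.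
Proof.
move=> h; apply: ge_sup; last by move=> _ [c c1 <-]; exact: h.
by exists (cnorm (unitz_act u 0)), 0 => //=; rewrite cnorm0.
Qed.

Lemma unitz_opnorm_ge0 u : 0 <= unitz_opnorm u.
Proof.
apply: le_trans (cnorm_ge0 _) (unitz_act_le1 u (c := 0) _).
by rewrite cnorm0.
Qed.

Lemma unitz_act_le u c : cnorm (unitz_act u c) <= unitz_opnorm u * cnorm c.
Proof.
have [c0|n0] := eqVneq (cnorm c) 0.
  by have := unitz_act_bound u c; rewrite c0 !mulr0.
have c0 : 0 < cnorm c by rewrite lt0r n0 cnorm_ge0.
have i0 : 0 <= (cnorm c)^-1 by rewrite invr_ge0 ltW.
rewrite -ler_pdivrMr // mulrC -[X in X * _](ger0_norm i0) -cmod_real -cnormZ.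
rewrite -unitz_actZr; apply: unitz_act_le1.
by rewrite cnormZ cmod_real ger0_norm // mulVf.
Qed.

Lemma unitz_opnormD u v : unitz_opnorm (u + v) <= unitz_opnorm u + unitz_opnorm v.
Proof.
apply: unitz_opnorm_le => c c1; rewrite unitz_actD.
by rewrite (le_trans (cnormD _ _)) // lerD // unitz_act_le1.
Qed.

Lemma unitz_opnormM u v : unitz_opnorm (u * v) <= unitz_opnorm u * unitz_opnorm v.
Proof.
apply: unitz_opnorm_le => c c1; rewrite unitz_actM.
apply: (le_trans (unitz_act_le _ _)); rewrite ler_wpM2l ?unitz_opnorm_ge0 //.
exact: unitz_act_le1.
Qed.

Lemma unitz_opnormZ r u : unitz_opnorm (r *: u) = `|r| * unitz_opnorm u.
Proof.
have h s v : unitz_opnorm (s *: v) <= `|s| * unitz_opnorm v.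
  apply: unitz_opnorm_le => c c1; rewrite unitz_actZ cnormZ cmod_real.
  by rewrite ler_wpM2l // unitz_act_le1.
apply/eqP; rewrite eq_le h /=.
have [->|r0] := eqVneq r 0; first by rewrite normr0 mul0r unitz_opnorm_ge0.
have r0' : 0 < `|r| by rewrite normr_gt0.
rewrite mulrC -ler_pdivlMr // mulrC -normfV (le_trans _ (h _ _)) //.
by rewrite scalerA mulVf // scale1r.
Qed.

Let star u : U := (u.1^*, cstar u.2).

Lemma unitz_act_star u c d :
  cmul (cstar (unitz_act u c)) d = cmul (cstar c) (unitz_act (star u) d).
Proof.
rewrite /unitz_act /= cstarD cstarZ cstarM cmulDl cmulDr cmulZl cmulZr.
by rewrite cmulA.
Qed.

(** For N c <= 1, the C*-identity of A turns the squared norm of u c into the norm of c^† (u^† u c),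
    at most the operator norm of u^† u. *)
Lemma unitz_opnorm_star_ge u : unitz_opnorm u ^+ 2 <= unitz_opnorm (star u * u).
Proof.
have s0 := unitz_opnorm_ge0 (star u * u).
rewrite -[X in _ <= X]sqr_sqrtr // lerXn2r ?nnegrE ?sqrtr_ge0 ?unitz_opnorm_ge0 //.
apply: unitz_opnorm_le => c c1.
rewrite -(@ler_pXn2r _ 2) ?nnegrE ?sqrtr_ge0 ?cnorm_ge0 // sqr_sqrtr //.
rewrite -cnorm_starM unitz_act_star -unitz_actM.
apply: (le_trans (cnorm_mul _ _)); rewrite cnorm_star.
rewrite -[X in _ <= X]mul1r; apply: ler_pM; rewrite ?cnorm_ge0 //.
exact: unitz_act_le1.
Qed.

Lemma unitz_opnorm_inj x : unitz_opnorm (0, x) = cnorm x.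
Proof.
have actE c : unitz_act (0, x) c = cmul x c by rewrite /unitz_act scale0r add0r.
apply/eqP; rewrite eq_le; apply/andP; split.
  apply: unitz_opnorm_le => c c1; rewrite actE (le_trans (cnorm_mul _ _)) //.
  by rewrite ler_piMr ?cnorm_ge0.
(* The adjoint is the right test vector: [cmul x (cstar x)] has norm [cnorm x ^+ 2]. *)
have := unitz_act_le (0, x) (cstar x); rewrite actE.
rewrite -{1}(cstarK x) cnorm_starM cnorm_star.
have [->|n0] := eqVneq (cnorm x) 0; first by rewrite unitz_opnorm_ge0.
by rewrite expr2 ler_pM2r // lt0r n0 cnorm_ge0.
Qed.

Lemma unitz_opnorm_scalar k : unitz_opnorm (k, 0) <= cmod k.
Proof.
apply: unitz_opnorm_le => c c1; rewrite /unitz_act cmul0l addr0 cnormZ.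
by rewrite ler_piMr // cmod_ge0.
Qed.

(* If [A] has a unit, the operator norm alone is only a seminorm. *)
Let norm u : R := Num.max (cmod u.1) (unitz_opnorm u).

Lemma unitz_cmod_le_norm u : cmod u.1 <= norm u.
Proof. by rewrite /norm le_max lexx. Qed.

Lemma unitz_opnorm_le_norm u : unitz_opnorm u <= norm u.
Proof. by rewrite /norm le_max lexx orbT. Qed.

Lemma unitz_norm_le u : norm u <= cmod u.1 + cnorm u.2.
Proof.
rewrite /norm ge_max lerDl cnorm_ge0 /=.
have {1}-> : u = (u.1, 0) + (0, u.2).
  by case: u => k x; congr pair; rewrite /= ?addr0 ?add0r.
apply: (le_trans (unitz_opnormD _ _)).
by apply: lerD; [exact: unitz_opnorm_scalar | rewrite unitz_opnorm_inj].
Qed.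

Lemma unitz_norm_ge_snd u : cnorm u.2 <= norm u + norm u.
Proof.
rewrite -unitz_opnorm_inj.
have -> : ((0, u.2) : U) = u + (- u.1, 0).
  by case: u => k x; congr pair; rewrite /= ?addr0 ?subrr.
apply: (le_trans (unitz_opnormD _ _)); apply: lerD.
  by exact: unitz_opnorm_le_norm.
by apply: (le_trans (unitz_opnorm_scalar _)); rewrite cmodN; exact: unitz_cmod_le_norm.
Qed.

Lemma unitz_normD u v : norm (u + v) <= norm u + norm v.
Proof.
rewrite /norm ge_max -/(norm u) -/(norm v); apply/andP; split.
  by apply: (le_trans (cmodD _ _)); apply: lerD; exact: unitz_cmod_le_norm.
by apply: (le_trans (unitz_opnormD _ _)); apply: lerD; exact: unitz_opnorm_le_norm.
Qed.

Lemma unitz_normZ r u : norm (r *: u) = `|r| * norm u.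
Proof. by rewrite /norm unitz_opnormZ /= cmodM cmod_real maxr_pMr. Qed.

Lemma unitz_normM u v : norm (u * v) <= norm u * norm v.
Proof.
rewrite /norm ge_max -/(norm u) -/(norm v); apply/andP; split.
  by rewrite cmodM; apply: ler_pM; rewrite ?cmod_ge0 // unitz_cmod_le_norm.
apply: (le_trans (unitz_opnormM _ _)).
by apply: ler_pM; rewrite ?unitz_opnorm_ge0 // unitz_opnorm_le_norm.
Qed.

(** Both seminorms satisfy the inequality, hence so does their maximum. *)
Lemma unitz_norm_star_ge u : norm u ^+ 2 <= norm (star u * u).
Proof.
have [->|->] : norm u = unitz_opnorm u \/ norm u = cmod u.1.
  by rewrite /norm; case: leP; [left | right].
  exact: le_trans (unitz_opnorm_star_ge u) (unitz_opnorm_le_norm _).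
by apply: le_trans (unitz_cmod_le_norm _); rewrite cmodM cmodJ expr2.
Qed.

Lemma unitz_norm_eq0 u : norm u = 0 -> u = 0.
Proof.
move=> n0; have := unitz_norm_ge_snd u; rewrite n0 addr0 => h2.
have h1 : cmod u.1 <= 0 by rewrite -n0 unitz_cmod_le_norm.
have e1 : u.1 = 0 by apply: cmod_eq0; apply/eqP; rewrite eq_le h1 cmod_ge0.
have e2 : u.2 = 0 by apply: cnorm_eq0; apply/eqP; rewrite eq_le h2 cnorm_ge0.
by case: u e1 e2 {n0 h1 h2} => ? ? /= -> ->.
Qed.

(** The norm is equivalent to [cmod u.1 + cnorm u.2], so limits are taken in each component. *)
Lemma unitz_norm_complete (u : nat -> U) :
  (forall e : R, 0 < e -> exists n : nat, forall m : nat,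
    (n <= m)%N -> norm (u m - u n) <= e) ->
  exists l : U, forall e : R, 0 < e -> exists n : nat, forall m : nat,
    (n <= m)%N -> norm (u m - l) <= e.
Proof.
move=> hu.
have [k hk] : exists k, forall e : R, 0 < e -> exists n : nat, forall m : nat,
    (n <= m)%N -> cmod ((u m).1 - k) <= e.
  apply: (@complex_seq_complete _ (fun n => (u n).1)) => e /hu [n hn].
  by exists n => m /hn; apply: le_trans; exact: (unitz_cmod_le_norm (u m - u n)).
have [x hx] : exists x : A, forall e : R[i], 0 < e -> exists n : nat,
    forall m : nat, (n <= m)%N -> `|(u m).2 - x| <= e.
  apply: (@cauchy_seq_complete _ A (fun n => (u n).2)) => e e0.
  have eE : e = (complex.Re e)%:C by rewrite RRe_real // gtr0_real.
  have r0 : 0 < complex.Re e / 2 by rewrite divr_gt0 // -ltcR -eE.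
  have [n hn] := hu _ r0; exists n => m /hn h.
  rewrite -cnormE eE lecR.
  apply: (le_trans (unitz_norm_ge_snd (u m - u n))).
  by rewrite [complex.Re e]splitr lerD.
exists (k, x) => e e0; have e2 : 0 < e / 2 by rewrite divr_gt0.
have [n hn] := hk _ e2; have e2' : 0 < (e / 2)%:C by rewrite ltcR.
have [p hp] := hx _ e2'.
exists (maxn n p) => m; rewrite geq_max => /andP[/hn h1 /hp h2].
apply: (le_trans (unitz_norm_le _)); rewrite [e]splitr lerD //.
by rewrite -lecR cnormE.
Qed.

Let I : U := ('i, 0).

Lemma unitz_I_sqr : I * I = -1.
Proof.
rewrite unitz_mulE /unitization_mul /= !scaler0 cmul0 !addr0 -expr2 sqr_i.
by congr pair; rewrite oppr0.
Qed.

Lemma unitz_I_comm u : I * u = u * I.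
Proof.
rewrite !unitz_mulE /unitization_mul /= !scaler0 cmul0 cmul0l !addr0 add0r.
by rewrite mulrC.
Qed.

Lemma unitz_starI : star I = - I.
Proof.
rewrite /star /= cstar0; congr pair; rewrite ?oppr0 //=.
by apply/eqP; rewrite eq_complex /= oppr0 !eqxx.
Qed.

Lemma unitz_starK : involutive star.
Proof. by move=> [k x]; rewrite /star /= conjcK cstarK. Qed.

Lemma unitz_starD : {morph star : u v / u + v}.
Proof. by move=> [k x] [l y]; rewrite /star /= rmorphD cstarD. Qed.

Lemma unitz_starZ r u : star (r *: u) = r *: star u.
Proof.
rewrite /star !unitz_scaleE; congr pair; rewrite ?cstarZ ?rmorphM;
  [congr (_ * _) | congr (_ *: _)]; exact: conjc_real.
Qed.

Lemma unitz_starM u v : star (u * v) = star v * star u.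
Proof.
rewrite !unitz_mulE /star /unitization_mul; congr pair; first by rewrite rmorphM mulrC.
by rewrite !cstarD !cstarZ cstarM; congr (_ + _); exact: addrC.
Qed.

HB.instance Definition _ := isUnitalCStar.Build R U unitz_I_sqr unitz_I_comm
  unitz_starI unitz_starK unitz_starD unitz_starZ unitz_starM unitz_normD
  unitz_normZ unitz_normM unitz_norm_star_ge unitz_norm_eq0 unitz_norm_complete.

End UnitizationNorm.

(** * The embedding of A: positivity, d, h and filters in the unitization *)

Section UnitizationEmbedding.
Local Open Scope complex_scope.
Context {R : realType} {A : cstarAlgType R}.
Local Notation U := (unitz A).
Implicit Types (a b x y : A) (t e : R).

Definition unitz_inj x : U := (0, x).
Local Notation i := unitz_inj.

Lemma unitz_injB x y : i (x - y) = i x - i y.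
Proof. by congr pair; rewrite /= subr0. Qed.

Lemma unitz_injD x y : i (x + y) = i x + i y.
Proof. by congr pair; rewrite /= addr0. Qed.

Lemma unitz_injM x y : i (cmul x y) = i x * i y.
Proof.
by rewrite unitz_mulE /unitization_mul /= mulr0 !scale0r !add0r.
Qed.

Lemma unitz_injZ t x : i (t%:C *: x) = t *: i x.
Proof. by rewrite unitz_scaleE /= mulr0. Qed.

Lemma unorm_inj x : unorm (i x) = cnorm x.
Proof.
rewrite /unorm /= unitz_opnorm_inj; apply/max_idPr.
by rewrite /cmod normr0 cnorm_ge0.
Qed.

Lemma usa_inj x : usa (i x) <-> selfadjoint x.
Proof.
rewrite /usa /selfadjoint; split=> [[] //|h].
by congr pair => //; exact: conjc0.
Qed.

(** [cpositive] speaks of complex spectral values and [upos] of real shifts; they agree because a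
    selfadjoint element has no nonreal spectrum. *)
Lemma upos_inj x : upos (i x) <-> cpositive x.
Proof.
split=> [[xs xp]|[xs xp]].
  split=> [|[a b]]; first exact/usa_inj.
  apply: contra_notT; rewrite lecE /= negb_and => h.
  suff : uinv (- ((a +i* b, - x) : U)) by exact: uinvN.
  have -> : - ((a +i* b, - x) : U) = i x + (- a)%:A + (- b) *: uI.
    congr pair; last by rewrite /= !scaler0 !addr0 opprK.
    apply/eqP; rewrite eq_complex /=.
    by rewrite !(mul0r, mulr0, mulr1, add0r, addr0, subr0) !eqxx.
  have [b0|b0] := eqVneq b 0.
    move: h; rewrite b0 eqxx /= -ltNge => a0.
    by rewrite oppr0 scale0r addr0; apply: xp; rewrite oppr_gt0.
  apply: uinv_sa_addI; last by rewrite oppr_eq0.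
  by apply: usaD => //; exact: usaA.
split=> [|d d0]; first exact/usa_inj.
apply: uinvN; have -> : - (i x + d%:A) = ((- d)%:C, - x).
  congr pair; last by rewrite /= scaler0 addr0.
  by rewrite /= mulr1 add0r rmorphN.
apply: contrapT => h; have := xp (- d)%:C h.
by rewrite ler0c oppr_ge0 leNgt d0.
Qed.

Lemma uunit_interval_inj a : pos_unit_ball a -> uunit_interval (i a).
Proof.
move=> [ap a1]; have ip : upos (i a) by apply/upos_inj.
split=> //; rewrite -[1]scale1r; apply: upos_scalar_sub; first exact: ip.1.
by rewrite unorm_inj.
Qed.

Lemma cabs_spec x : selfadjoint x ->
  cpositive (cabs x) /\ cmul (cabs x) (cabs x) = cmul x x.
Proof.
move=> xs; rewrite /cabs xs /possqrt.
apply: (@xgetPex _ 0 [set b | cpositive b /\ cmul b b = cmul x x]).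
have ixs : usa (i x) by apply/usa_inj.
have [[k s] [sp sE _]] := upos_sqrt (upos_sqr ixs).
(* The root found in the unitization lies in A: its scalar part squares to that of (i x)^2, which is
   0. *)
have k0 : k = 0.
  move/(congr1 fst): (sE); rewrite !unitz_mulE /= mulr0 => /eqP.
  by rewrite mulf_eq0 orbb => /eqP.
rewrite k0 -/(i s) in sp sE.
exists s; split; first exact/upos_inj.
by move: sE; rewrite -!unitz_injM => -[].
Qed.

Lemma hh_le a b t : cpositive a -> cpositive b -> 0 <= t ->
  (hh a b <= t%:E)%E <-> upos (t%:A - (i a - i b)).
Proof.
move=> ap bp t0.
have xs : selfadjoint (a - b).
  apply/usa_inj; rewrite unitz_injB.
  by apply: usaB; apply/usa_inj; [exact: ap.1 | exact: bp.1].
have [cp cE] := cabs_spec xs.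
rewrite /hh lee_fin -unorm_inj -unitz_injB.
have -> : i (pospart (a - b)) = 2^-1 *: (i (cabs (a - b)) + i (a - b)).
  rewrite -unitz_injD -unitz_injZ /pospart; congr (i (_ *: _)).
  by rewrite fmorphV rmorph_nat.
apply: unorm_upospart_le => //; first exact/usa_inj.
  exact/upos_inj.
by rewrite -!unitz_injM cE.
Qed.

Lemma dd_unorm a b : dd a b = (unorm (i a - i a * i b))%:E.
Proof. by rewrite -unitz_injM -unitz_injB unorm_inj. Qed.

(** The filter condition for the pair (a, a) makes the infimum of 2 d(c, a) over c in F vanish. *)
Lemma dfilter_approx (F : set A) a e : dfilter F -> F a -> 0 < e ->
  exists2 c, F c & unorm (i c - i c * i a) <= e.
Proof.
move=> [F1 hF] Fa e0; have [/(_ (conj Fa Fa)) h _] := hF _ _ (F1 _ Fa) (F1 _ Fa).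
apply: contrapT => hn.
have : (e%:E <= ereal_inf [set (dd c a + dd c a)%E | c in F])%E.
  apply: le_ereal_inf_tmp => _ [c Fc <-].
  rewrite dd_unorm -EFinD lee_fin leNgt; apply/negP => lt; apply: hn.
  by exists c => //; have := unorm_ge0 (i c - i c * i a); lra.
by rewrite h lee_fin leNgt e0.
Qed.

End UnitizationEmbedding.

(** * Comparison of the two inf-sup expressions *)

Lemma nneg_sup_leP (R : realType) (T : Type) (G : set T) (f : T -> \bar R) (t : R) :
  0 <= t -> (nneg_sup [set f b | b in G] <= t%:E)%E <->
  (forall b, G b -> f b <= t%:E)%E.
Proof.
move=> t0; rewrite /nneg_sup ge_max lee_fin t0 /=; split.
  by move=> /ereal_supP h b Gb; apply: h; exists b.
by move=> h; apply/ereal_supP => _ [b Gb <-]; exact: h.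
Qed.

(** Common shape of the two inequalities, with d and h exchanging the roles of f and g. The witness
    a' may depend on a, t and e but must serve all b at once. *)
Lemma ereal_inf_nneg_sup_le (R : realType) (T S : Type) (F : set T) (G : set S)
    (f g : T -> S -> \bar R) :
  (forall a t e, F a -> 0 <= t -> 0 < e -> (forall b, G b -> f a b <= t%:E)%E ->
    exists2 a', F a' & forall b, G b -> (g a' b <= (t + e)%:E)%E) ->
  (ereal_inf [set nneg_sup [set g a b | b in G] | a in F] <=
   ereal_inf [set nneg_sup [set f a b | b in G] | a in F])%E.
Proof.
move=> h; apply: le_ereal_inf_tmp => _ [a Fa <-].
have : (0 <= nneg_sup [set f a b | b in G])%E by rewrite le_max lexx.
(* The value -oo is ruled out by the floor at 0 in [nneg_sup], and +oo is a trivial bound. *)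
case E : (nneg_sup _) => [t| |] //; last by move=> _; rewrite leey.
rewrite lee_fin => t0; apply/lee_addgt0Pr => e e0.
have [|a' Fa' ha'] := h a t e Fa t0 e0.
  by apply/nneg_sup_leP => //; rewrite E.
apply: ge_ereal_inf; exists (nneg_sup [set g a' b | b in G]); first by exists a'.
by rewrite -EFinD; apply/nneg_sup_leP => //; rewrite addr_ge0 // ltW.
Qed.

Theorem theorem3p10 (R : realType) (A : cstarAlgType R) (F G : set A)
    (hF : dfilter F) (hG : dfilter G) :
  ereal_inf [set nneg_sup [set dd a b | b in G] | a in F] =
  ereal_inf [set nneg_sup [set hh a b | b in G] | a in F].
Proof.
have FI a : F a -> uunit_interval (unitz_inj a).
  by move=> /hF.1; exact: uunit_interval_inj.
have GI b : G b -> uunit_interval (unitz_inj b).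
  by move=> /hG.1; exact: uunit_interval_inj.
apply/eqP; rewrite eq_le; apply/andP; split; apply: ereal_inf_nneg_sup_le.
- move=> a t e Fa t0 e0 ht.
  (* If m > t + e, then m and m - t are at least e, so m^2 (m - t) >= e^3, whereas the estimate
     allows only 5 e^3 / 10. *)
  have e5 : 0 < e ^+ 3 / 10 by rewrite divr_gt0 // exprn_gt0.
  have [p Fp hp] := dfilter_approx hF Fa e5.
  exists p => // b Gb; have [f Gf hf] := dfilter_approx hG Gb e5.
  have haf := (hh_le (hF.1 _ Fa).1 (hG.1 _ Gf).1 t0).1 (ht _ Gf).
  have := dist_le_of_upos_sub (FI _ Fp) (FI _ Fa) (GI _ Gb) (GI _ Gf) t0
    (ltW e5) haf hp hf.
  rewrite dd_unorm lee_fin; set m := unorm _ => hm.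
  rewrite leNgt; apply/negP => lt.
  have em : e <= m by lra.
  have : e ^+ 2 * e <= m ^+ 2 * (m - t).
    by apply: ler_pM; rewrite ?sqr_ge0 ?lerXn2r ?nnegrE //; lra.
  have := exprn_gt0 3 e0; rewrite (exprSr e 2); lra.
- move=> a t e Fa t0 e0 ht.
  (* The loss 4 (e / 8) is one half of e; the other half makes the bound t + e / 2 strictly positive
     even for t = 0. *)
  have e8 : 0 < e / 8 by rewrite divr_gt0.
  have [p Fp hp] := dfilter_approx hF Fa e8.
  exists p => // b Gb; have [f Gf hf] := dfilter_approx hG Gb e8.
  apply/(hh_le (hF.1 _ Fp).1 (hG.1 _ Gb).1); first by rewrite addr_ge0 // ltW.
  have m0 : 0 < t + e / 2 by lra.
  have haf : unorm (unitz_inj a - unitz_inj a * unitz_inj f) <= t + e / 2.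
    by have := ht _ Gf; rewrite dd_unorm lee_fin; lra.
  have := upos_sub_le_dist (FI _ Fa) (FI _ Fp) (GI _ Gb) (GI _ Gf) hp hf m0 haf.
  by have -> : t + e / 2 + 4 * (e / 8) = t + e by field.
Qed.
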